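(* Let $A\subseteq \mathbb B(H)$ be a (not necessarily unital) $C^*$-algebra acting non-degenerately on a Hilbert space $H$. For $(t_n)_n\in \ell^2_{\mathrm{strong}}(LM(A))$ and $(a_n)_n\in\ell^2(A)$ put $$L_{(t_n)_n}((a_n)_n)=\sum_{n=1}^{\infty}a_nt_n^*.$$ Then this series converges in norm in $A$, and the map $$\varphi:\ell^2_{\mathrm{strong}}(LM(A))\to \ell^2(A)',\qquad \varphi((t_n)_n)=L_{(t_n)_n},$$ is an anti-linear isometric isomorphism of Banach $A$-modules. Moreover, its restriction $$\varphi|_{M(\ell^2(A))}:M(\ell^2(A))\to\ell^2(A)^*$$ is an anti-linear isometric isomorphism of Hilbert $M(A)$-modules. In particular, $\varphi$ restricted to $\ell^2(A)$ is the standard embedding $x\mapsto L_x$, $L_x(y)=\langle y,x\rangle$, $x,y\in \ell^2(A)$.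
   Context: All Hilbert $C^*$-modules are left modules, with inner products linear in the first variable. $\overline{A}^s$ is the closure of $A$ in the strong operator topology of $\mathbb B(H)$ (which equals $A''$). $LM(A)=\{t\in \mathbb B(H): tA\subseteq A\}$, $RM(A)=\{t\in \mathbb B(H): At\subseteq A\}$ and $M(A)=LM(A)\cap RM(A)$ are the left, right and two-sided multipliers of $A$; all are contained in $\overline{A}^s$, and $t\mapsto t^*$ maps $LM(A)$ onto $RM(A)$. The strict topology on $M(A)$ is generated by the seminorms $x\mapsto\|ax\|$, $x\mapsto\|xa\|$, $a\in A$. $\ell^2(A)=\{(a_n)_{n\in\mathbb N}: a_n\in A,\ \sum_n a_na_n^*\text{ converges in norm}\}$ with $\langle (a_n),(b_n)\rangle=\sum_n a_nb_n^*$. $M(\ell^2(A))=\{(c_n)_n: c_n\in M(A),\ \sum_n c_nc_n^*\text{ converges strictly}\}$, a Hilbert $M(A)$-module with inner product $\langle (c_n),(d_n)\rangle=\text{(strict)}\sum_n c_nd_n^*$. $\ell^2_{\mathrm{strong}}(LM(A))=\{(c_n)_n: c_n\in LM(A),\ \sup_N\|\sum_{n=1}^Nc_nc_n^*\|<\infty\}$, with norm $\|(c_n)_n\|=\|\text{(strong)}\sum_n c_nc_n^*\|^{1/2}$ (strong operator convergence) and left $A$-action $a(c_n)_n=(ac_n)_n$. One has $\ell^2(A)\subseteq M(\ell^2(A))\subseteq \ell^2_{\mathrm{strong}}(LM(A))$. For a Hilbert $A$-module $X$, $X'$ is the Banach space of all bounded module maps $L:X\to A$ (linear with $L(ax)=aL(x)$),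 with the operator norm; $X^*=\mathbb B(X,A)\subseteq X'$ is the subspace of adjointable maps ($A$ being a Hilbert module over itself with $\langle a,b\rangle=ab^*$). $X'$ is a right Banach $A$-module via $(Lb)(x)=L(x)b$; likewise $X^*$ is a right $M(A)$-module via $(Lm)(x)=L(x)m$, and it carries the $M(A)$-valued inner product $[L,K]$ equal to the element $m\in M(A)$ determined by $KL^*(b)=bm$ for all $b\in A$. An anti-linear isomorphism from a left module to a right module is an anti-linear bijection with $\varphi(at)=\varphi(t)a^*$; for Hilbert modules it also satisfies $[\varphi(t),\varphi(s)]=\langle t,s\rangle$. *)

(* Defs.v *)
From HB Require Import structures.
From mathcomp Require Import all_boot all_order all_algebra.
From mathcomp Require Import all_classical all_reals all_analysis.
From mathcomp Require Import complex.

Set Implicit Arguments.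
Unset Strict Implicit.
Unset Printing Implicit Defensive.

Import Order.TTheory GRing.Theory Num.Theory.
Import numFieldNormedType.Exports.

Local Open Scope classical_set_scope.
Local Open Scope ring_scope.
Local Open Scope complex_scope.

HB.mixin Record NormedModule_isHilbert (R : realType) H
    & CompleteNormedModule R[i] H := {
  inner : H -> H -> R[i] ;
  inner_linearl : forall (k : R[i]) (x y z : H),
    inner (k *: x + y) z = k * inner x z + inner y z ;
  inner_conj : forall x y : H, inner y x = (inner x y)^* ;
  inner_norm : forall x : H, inner x x = `|x| ^+ 2
}.

#[short(type="hilbertType")]
HB.structure Definition Hilbert (R : realType) :=
  {H of CompleteNormedModule R[i] H & NormedModule_isHilbert R H}.

Section BoundedOperators.
Context {R : realType} (H : hilbertType R).

Definition bounded_linear : {pred H -> H} :=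
  [pred f | `[< linear f /\ exists M : R, forall x, `|f x| <= M%:C * `|x| >]].

Lemma bounded_linearP (f : H -> H) :
  reflect (linear f /\ exists M : R, forall x, `|f x| <= M%:C * `|x|)
          (f \in bounded_linear).
Proof. by rewrite inE; exact: asboolP. Qed.

Record bop := Bop { bop_fun :> H -> H ; bop_funP : bop_fun \in bounded_linear }.

HB.instance Definition _ := [isSub for bop_fun].
HB.instance Definition _ := [Choice of bop by <:].

Lemma bounded_linear_submod : submod_closed bounded_linear.
Proof.
split.
  apply/bounded_linearP; split; first by move=> k x y; rewrite /= scaler0 addr0.
  by exists 0 => x; rewrite normr0 mul0r.
move=> k f g /bounded_linearP[lf [M fM]] /bounded_linearP[lg [N gN]].
apply/bounded_linearP; split.
  move=> l x y; rewrite !fctE lf lg !scalerDr !scalerA (mulrC k l) -!addrA.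
  by congr (_ + _); rewrite addrCA.
exists (complex.Re `|k| * M + N) => x; rewrite !fctE.
have -> : (complex.Re `|k| * M + N)%:C = `|k| * M%:C + N%:C :> R[i].
  have /complex_realP[r ->] := normr_real k.
  by rewrite -rmorphM -rmorphD.
rewrite (le_trans (ler_normD _ _))// mulrDl lerD// normrZ -mulrA.
by rewrite ler_wpM2l.
Qed.

HB.instance Definition _ :=
  GRing.isSubmodClosed.Build R[i] (H -> H) bounded_linear bounded_linear_submod.
HB.instance Definition _ := [SubChoice_isSubLmodule of bop by <:].


Lemma bop_linear (T : bop) : linear T.
Proof. by have /bounded_linearP[] := bop_funP T. Qed.

Lemma bop_bounded (T : bop) : exists M : R, forall x, `|T x| <= M%:C * `|x|.
Proof. by have /bounded_linearP[] := bop_funP T. Qed.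

Lemma bop0 (T : bop) : T 0 = 0.
Proof. by rewrite -[in LHS](subrr 0) -scaleN1r addrC bop_linear scaleN1r addNr. Qed.

Lemma bopZ (T : bop) k x : T (k *: x) = k *: T x.
Proof. by rewrite -[k *: x]addr0 bop_linear bop0 addr0. Qed.

Lemma bopP (S T : bop) : S =1 T -> S = T.
Proof. by move=> ST; apply/val_inj/funext. Qed.

Lemma bop_addE (S T : bop) x : (S + T) x = S x + T x.
Proof. by []. Qed.

Lemma bop_scaleE k (T : bop) x : (k *: T) x = k *: T x.
Proof. by []. Qed.

Lemma Re_normE (x : H) : (complex.Re `|x|)%:C = `|x|.
Proof. by have /complex_realP[r ->] := normr_real x. Qed.

(* the norm of H takes its (real) values in R[i] *)
Definition opnorm (T : bop) : R :=
  sup [set complex.Re `|T x| | x in [set x : H | `|x| <= 1]].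

Lemma opnorm_has_sup (T : bop) :
  has_sup [set complex.Re `|T x| | x in [set x : H | `|x| <= 1]].
Proof.
split; first by exists (complex.Re `|T 0|), 0 => //=; rewrite normr0.
have [M TM] := bop_bounded T.
exists `|M| => _ [x /= x1 <-]; rewrite -lecR Re_normE (le_trans (TM x))//.
rewrite (@le_trans _ _ (`|M|%:C * `|x|))//.
  by rewrite ler_wpM2r// lecR ler_norm.
by rewrite ler_piMr// lecR.
Qed.

Lemma opnormP (T : bop) x : `|T x| <= (opnorm T)%:C * `|x|.
Proof.
have [->|x0] := eqVneq x 0; first by rewrite bop0 !normr0 mulr0.
have nx : `|x| != 0 by rewrite normr_eq0.
have nx0 : 0 < `|x| by rewrite normr_gt0.
rewrite -ler_pdivrMr// mulrC.
have -> : `|x|^-1 * `|T x| = `|T (`|x|^-1 *: x)|.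
  by rewrite bopZ normrZ normfV normr_id.
rewrite -Re_normE lecR; apply: ub_le_sup.
  by have [] := opnorm_has_sup T.
by exists (`|x|^-1 *: x) => //=; rewrite normrZ normfV normr_id mulVf.
Qed.

Lemma opnorm_le (T : bop) (M : R) : (forall x, `|x| <= 1 -> `|T x| <= M%:C) ->
  opnorm T <= M.
Proof.
move=> TM; apply: ge_sup; first by have [] := opnorm_has_sup T.
by move=> _ [x /= x1 <-]; rewrite -lecR Re_normE TM.
Qed.

Lemma opnorm_ge0 (T : bop) : 0 <= opnorm T.
Proof.
apply: ub_le_sup; first by have [] := opnorm_has_sup T.
by exists 0; rewrite /= ?bop0 normr0.
Qed.

Lemma ler_opnormD (S T : bop) :
  (opnorm (S + T))%:C <= (opnorm S)%:C + (opnorm T)%:C :> R[i].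
Proof.
rewrite -rmorphD lecR; apply: opnorm_le => x x1.
rewrite bop_addE rmorphD (le_trans (ler_normD _ _))// lerD//.
  by rewrite (le_trans (opnormP _ _))// ler_piMr// lecR opnorm_ge0.
by rewrite (le_trans (opnormP _ _))// ler_piMr// lecR opnorm_ge0.
Qed.

Lemma opnormZ_le (k : R[i]) (T : bop) :
  (opnorm (k *: T))%:C <= `|k| * (opnorm T)%:C.
Proof.
have /complex_realP[r kr] := normr_real k.
rewrite kr -rmorphM lecR; apply: opnorm_le => x x1.
rewrite bop_scaleE normrZ kr rmorphM ler_wpM2l//; first by rewrite -kr.
by rewrite (le_trans (opnormP _ _))// ler_piMr// lecR opnorm_ge0.
Qed.

Lemma opnormZ (k : R[i]) (T : bop) : (opnorm (k *: T))%:C = `|k| * (opnorm T)%:C.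
Proof.
apply/eqP; rewrite eq_le opnormZ_le /=.
have [->|k0] := eqVneq k 0; first by rewrite normr0 mul0r lecR opnorm_ge0.
rewrite -ler_pdivlMl ?normr_gt0// -normfV.
by rewrite -[in leLHS](scalerK k0 T) opnormZ_le.
Qed.

Lemma opnorm0_eq0 (T : bop) : (opnorm T)%:C = 0 :> R[i] -> T = 0.
Proof.
move=> T0; apply: bopP => x; apply/eqP; rewrite -normr_le0.
by rewrite (le_trans (opnormP _ _))// T0 mul0r.
Qed.

HB.instance Definition _ :=
  @Lmodule_isNormed.Build R[i] bop (fun T => (opnorm T)%:C)
    ler_opnormD opnormZ opnorm0_eq0.

Lemma bop_normE (T : bop) : `|T| = (opnorm T)%:C.
Proof. by []. Qed.

Lemma bounded_linear_id : idfun \in bounded_linear.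
Proof. by apply/bounded_linearP; split=> //; exists 1 => x; rewrite mul1r. Qed.

Lemma bounded_linear_comp (S T : bop) : S \o T \in bounded_linear.
Proof.
apply/bounded_linearP; split; first by move=> k x y; rewrite /= !bop_linear.
exists (opnorm S * opnorm T) => x; rewrite rmorphM -mulrA /=.
by rewrite (le_trans (opnormP _ _))// ler_wpM2l ?opnormP// lecR opnorm_ge0.
Qed.

Definition bop_one : bop := Bop bounded_linear_id.
Definition bop_mul (S T : bop) : bop := Bop (bounded_linear_comp S T).

Fact bop_mulA : associative bop_mul.
Proof. by move=> S T U; apply: bopP. Qed.
Fact bop_mul1 : left_id bop_one bop_mul.
Proof. by move=> T; apply: bopP. Qed.
Fact bop_mulr1 : right_id bop_one bop_mul.
Proof. by move=> T; apply: bopP. Qed.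
Fact bop_mulDl : left_distributive bop_mul +%R.
Proof. by move=> S T U; apply: bopP. Qed.
Fact bop_mulDr : right_distributive bop_mul +%R.
Proof.
move=> S T U; apply: bopP => x.
by have := bop_linear S 1 (T x) (U x); rewrite !scale1r.
Qed.

HB.instance Definition _ :=
  GRing.Zmodule_isPzRing.Build bop bop_mulA bop_mul1 bop_mulr1 bop_mulDl bop_mulDr.

Lemma bop_mulE (S T : bop) x : (S * T) x = S (T x).
Proof. by []. Qed.

End BoundedOperators.

Section OperatorAlgebras.
Context {R : realType} {H : hilbertType R}.
Local Notation B := (bop H).

(* [T] has exactly one adjoint, by the Riesz representation theorem *)
Definition adj (T : B) : B :=
  xget 0 [set S : B | forall x y : H, inner (T x) y = inner x (S y)].

Definition Cstar_algebra (A : set B) : Prop :=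
  [/\ A 0,
      forall (k : R[i]) (a b : B), A a -> A b -> A (k *: a + b),
      forall a b : B, A a -> A b -> A (a * b),
      forall a : B, A a -> A (adj a) &
      closed A].

Definition acts_nondegenerately (A : set B) : Prop :=
  closure [set y : H | exists n (a : 'I_n -> B) (x : 'I_n -> H),
    (forall i, A (a i)) /\ y = \sum_(i < n) a i (x i)] = setT.

Definition LM (A : set B) : set B := [set t | forall a, A a -> A (t * a)].
Definition RM (A : set B) : set B := [set t | forall a, A a -> A (a * t)].
Definition multipliers (A : set B) : set B := LM A `&` RM A.

Definition strict_cvg (A : set B) (u : nat -> B) (m : B) : Prop :=
  multipliers A m /\ forall a, A a ->
    (fun n => a * u n) @ \oo --> a * m /\ (fun n => u n * a) @ \oo --> m * a.

Definition strong_cvg (u : nat -> B) (T : B) : Prop :=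
  forall x : H, (fun n => u n x) @ \oo --> T x.

Definition lact (b : B) (c : nat -> B) : nat -> B := fun n => b * c n.

(* the terms [c n * adj (d n)] of the series defining the inner products *)
Definition ip_terms (c d : nat -> B) : nat -> B := fun n => c n * adj (d n).

(* ell^2(A); [series] and [cvgn], [limn] refer to the norm topology of [B] *)
Definition l2 (A : set B) : set (nat -> B) :=
  [set a | (forall n, A (a n)) /\ cvgn (series (ip_terms a a))].

Definition l2_inner (a b : nat -> B) : B := limn (series (ip_terms a b)).

Definition l2_norm (a : nat -> B) : R := Num.sqrt (opnorm (l2_inner a a)).

(* M(ell^2(A)) *)
Definition Ml2 (A : set B) : set (nat -> B) :=
  [set c | (forall n, multipliers A (c n)) /\
           exists m, strict_cvg A (series (ip_terms c c)) m].

Definition Ml2_inner (A : set B) (c d : nat -> B) : B :=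
  xget 0 [set m | strict_cvg A (series (ip_terms c d)) m].

Definition Ml2_norm (A : set B) (c : nat -> B) : R :=
  Num.sqrt (opnorm (Ml2_inner A c c)).

(* ell^2_strong(LM(A)) *)
Definition l2strong (A : set B) : set (nat -> B) :=
  [set c | (forall n, LM A (c n)) /\
           exists K : R, forall N, opnorm (series (ip_terms c c) N) <= K].

Definition l2strong_norm (c : nat -> B) : R :=
  Num.sqrt (opnorm (xget 0 [set T | strong_cvg (series (ip_terms c c)) T])).

(* ell^2(A)'; as [l2 A] is only a set, the sum and the multiples of its       *)
(* elements are taken in the ambient space [nat -> B]                         *)
Definition l2_dual (A : set B) : set (set_type (l2 A) -> B) :=
  [set L | [/\ forall x, A (L x),
      forall (k : R[i]) (x y z : set_type (l2 A)),
        val z = k *: val x + val y -> L z = k *: L x + L y,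
      forall a (x z : set_type (l2 A)), A a ->
        val z = lact a (val x) -> L z = a * L x &
      exists K : R, forall x, opnorm (L x) <= K * l2_norm (val x)]].

Definition l2_dual_norm (A : set B) (L : set_type (l2 A) -> B) : R :=
  sup [set opnorm (L x) | x in [set x | l2_norm (val x) <= 1]].

Definition is_adjoint (A : set B) (L : set_type (l2 A) -> B)
    (Ls : set_type A -> set_type (l2 A)) : Prop :=
  forall x b, L x * adj (val b) = l2_inner (val x) (val (Ls b)).

(* ell^2(A)^* *)
Definition l2_adjointable (A : set B) : set (set_type (l2 A) -> B) :=
  [set L | l2_dual L /\ exists Ls, is_adjoint L Ls].

(* [L, K] *)
Definition l2_adjointable_inner (A : set B) (L K : set_type (l2 A) -> B) : B :=
  xget 0 [set m | multipliers A m /\ exists2 Ls, is_adjoint L Ls &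
    forall b : set_type A, K (Ls b) = val b * m].

Definition ract (T : Type) (L : T -> B) (b : B) : T -> B := fun x => L x * b.

(* [f] is an anti-linear isometric isomorphism from the left [S]-module [X],  *)
(* with norm [nX], onto the right [S]-module [Y], with norm [nY]              *)
Definition antilinear_isometric_iso (S : set B) (T : Type)
    (X : set (nat -> B)) (nX : (nat -> B) -> R)
    (Y : set (T -> B)) (nY : (T -> B) -> R) (f : (nat -> B) -> (T -> B)) : Prop :=
  [/\ (forall (k : R[i]) t s, X t -> X s -> X (k *: t + s)) /\
      (forall b t, S b -> X t -> X (lact b t)),
      (forall (k : R[i]) L K, Y L -> Y K -> Y (k *: L + K)) /\
      (forall b L, S b -> Y L -> Y (ract L b)),
      set_bij X Y f,
      (forall (k : R[i]) t s, X t -> X s -> f (k *: t + s) = k^* *: f t + f s) /\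
      (forall b t, S b -> X t -> f (lact b t) = ract (f t) (adj b)) &
      forall t, X t -> nY (f t) = nX t].

Definition phi (A : set B) (t : nat -> B) : set_type (l2 A) -> B :=
  fun a => limn (series (ip_terms (val a) t)).

End OperatorAlgebras.

Arguments l2_dual {R H} A _.
Arguments l2_dual_norm {R H} A L.
Arguments l2_adjointable {R H} A _.
Arguments l2_adjointable_inner {R H} A L K.
Arguments phi {R H} A t _.

(* Main.v *)
(* Riesz representation, obtained by minimising |x|^2 - 2 g(x), gives adjoints,
   and everything is then measured by the quadratic forms
   z |-> \sum_n |c_n^* z|^2.  Such a form bounds the row operator
   (y_n)_n |-> \sum_n c_n y_n, which yields the convergence of all the series.
   A has contractive selfadjoint approximate units u = 1 - (1 - c)^(2k), with c a
   small multiple of \sum_i a_i a_i^*; by nondegeneracy they converge strongly to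
   the identity.
   Testing L_t on x_n = t_n u and letting u -> 1 gives |t| <= |L_t|.  Conversely, a
   bounded module map L on l^2(A) restricts on the n-th coordinate to a map
   a |-> a t_n^*, where t_n is the strong limit of L(u e_n)^*; L and L_t agree on
   finite sequences, hence everywhere.  Finally c is in M(l^2(A)) exactly when it
   is a bounded sequence of multipliers with a c in l^2(A) for all a in A, and
   b |-> b c is then the adjoint of L_c. *)
Require Import Defs.
From mathcomp Require Import all_boot all_order all_algebra.
From mathcomp Require Import all_classical all_reals all_analysis.
From mathcomp Require Import complex ring lra zify.

Set Implicit Arguments.
Unset Strict Implicit.
Unset Printing Implicit Defensive.

Import Order.TTheory GRing.Theory Num.Theory.
Import numFieldNormedType.Exports.

Local Open Scope classical_set_scope.
Local Open Scope ring_scope.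

(** Since [A] may lack a unit, the standard basis of l^2 is out of reach, and since the t_n are only
    left multipliers, t itself need not be in l^2(A). Approximate units u bridge both gaps: e_n u
    and t_n u have their entries in [A]. The polynomial 1 - (1 - c)^m in a positive contraction c
    has no constant term, so it lies in [A]; it takes the place of inverses and functional calculus,
    because the quadratic form of c (1 - c)^m at x is at most |x|^2 / (m + 1). The even exponent
    keeps the unit contractive by a direct computation. Quadratic forms turn order between operators
    into real inequalities and make restriction to fewer indices monotone. The pairing of two rows
    is Cauchy in norm as soon as one has uniformly small tails and the other is bounded; this
    asymmetry is why l^2(A) pairs with the larger space of bounded rows. Strict convergence of
    \sum_n c_n c_n^* is not visibly preserved under sums, because of the cross terms; hence the
    detour through the rows a c. *)

Section RealNorm.
Context {R : realType}.
Local Open Scope complex_scope.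

(** * Real-valued norms and convergence over complex scalars *)

Section NormedModule.
Context {V : normedModType R[i]}.
Implicit Types x y z : V.

(** Norms over [R[i]] are complex numbers; their real parts lose nothing and give access to square
    roots, suprema and [lra]. *)
Definition rnorm x : R := complex.Re `|x|.

Lemma rnormE x : `|x| = (rnorm x)%:C.
Proof. by rewrite /rnorm RRe_real// normr_real. Qed.

Lemma rnorm_ge0 x : 0 <= rnorm x.
Proof. by rewrite -lecR -rnormE normr_ge0. Qed.

Lemma rnorm0 : rnorm 0 = 0.
Proof. by rewrite /rnorm normr0. Qed.

Lemma rnorm_eq0 x : rnorm x = 0 -> x = 0.
Proof. by move=> x0; apply/eqP; rewrite -normr_eq0 rnormE x0. Qed.

Lemma rnormD x y : rnorm (x + y) <= rnorm x + rnorm y.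
Proof. by rewrite -lecR rmorphD/= -!rnormE ler_normD. Qed.

Lemma rnormN x : rnorm (- x) = rnorm x.
Proof. by rewrite /rnorm normrN. Qed.

Lemma rnormC x y : rnorm (x - y) = rnorm (y - x).
Proof. by rewrite -rnormN opprB. Qed.

Lemma rnormZ (k : R[i]) x : rnorm (k *: x) = complex.Re `|k| * rnorm x.
Proof. by rewrite {1}/rnorm normrZ (rnormE x); have /complex_realP[r ->] := normr_real k; rewrite -rmorphM. Qed.

Lemma rnormZr (k : R) x : rnorm (k%:C *: x) = `|k| * rnorm x.
Proof. by rewrite rnormZ normc_def/= expr0n/= addr0 sqrtr_sqr. Qed.

Lemma rnormB_le x y z : rnorm (x - z) <= rnorm (x - y) + rnorm (y - z).
Proof. by rewrite (le_trans _ (rnormD _ _))// addrA subrK. Qed.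

Lemma cvg_rnormP (T : Type) (F : set_system T) {FF : Filter F} (f : T -> V) l :
  f @ F --> l <-> forall e : R, 0 < e -> \forall t \near F, rnorm (l - f t) < e.
Proof.
split=> [/cvgrPdist_lt fl e e0|fl].
  have := fl e%:C; rewrite ltcR => /(_ e0); apply: filterS => t.
  by rewrite rnormE ltcR.
(* A tolerance that is positive in [R[i]] has imaginary part 0, so only its real part matters. *)
apply/cvgrPdist_lt => e; rewrite ltcE/= => /andP[/eqP e0 eR].
have := fl _ eR; apply: filterS => t; rewrite rnormE ltcE/= => ->.
by rewrite e0 eqxx.
Qed.

Lemma cvg_seq_rnormP (u : nat -> V) l :
  u @ \oo --> l <->
  forall e : R, 0 < e -> exists N, forall n, (N <= n)%N -> rnorm (l - u n) < e.
Proof.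
split=> [/cvg_rnormP ul e /ul[N _ Nu]|ul]; first by exists N => n /Nu.
by apply/cvg_rnormP => e /ul[N Nu]; exists N.
Qed.

Lemma cvg_rnorm_le (T : Type) (F : set_system T) {FF : ProperFilter F} (f : T -> V)
    l (K : R) : f @ F --> l -> (\forall t \near F, rnorm (f t) <= K) -> rnorm l <= K.
Proof.
move=> /cvg_rnormP ul uK; apply/ler_addgt0Pr => e e0.
near F => n; rewrite -(subrK (f n) l) (le_trans (rnormD _ _))// addrC lerD//.
  by near: n.
by apply/ltW; near: n; exact: ul.
Unshelve. all: by end_near. Qed.

Lemma cvg_rnorm_unique (T : Type) (F : set_system T) {FF : ProperFilter F}
    (f : T -> V) (a b : V) : f @ F --> a -> f @ F --> b -> a = b.
Proof. exact: cvg_unique (@norm_hausdorff _ _) _ _ _ _. Qed.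

End NormedModule.

Lemma cauchy_rnorm_cvg (V : completeNormedModType R[i]) (T : Type)
    (F : set_system T) {FF : ProperFilter F} (f : T -> V) :
  (forall e : R, 0 < e ->
    exists2 P, F P & forall s t, P s -> P t -> rnorm (f s - f t) < e) ->
  cvg (f @ F).
Proof.
move=> fF; suff: cauchy (f @ F) by exact: cauchy_cvg.
apply: cauchy_exP => e.
rewrite ltcE/= => /andP[/eqP e0 eR]; have [P FP Pf] := fF _ eR.
have [s Ps] := filter_ex FP; exists (f s); near=> t.
rewrite -ball_normE/= rnormE ltcE/= e0 eqxx/=; apply: Pf => //.
by near: t.
Unshelve. all: by end_near. Qed.

Lemma cauchy_seq_cvg (V : completeNormedModType R[i]) (u : nat -> V) :
  (forall e : R, 0 < e ->
    exists N, forall m n, (N <= m)%N -> (m <= n)%N -> rnorm (u n - u m) < e) ->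
  cvgn u.
Proof.
move=> uC; apply: cauchy_rnorm_cvg => e /uC[N Nu].
exists [set n | (N <= n)%N]; first by exists N.
move=> m n /= Nm Nn; case: (leqP m n) => [mn|/ltnW nm]; last exact: Nu.
by rewrite rnormC; exact: Nu.
Qed.

(** Covers evaluation at a vector, multiplication by an operator and [adj] at once. [K] may have any
    sign, hence the positive divisor |K| + 1. *)
Lemma cvg_lipschitz (V W : normedModType R[i]) (g : V -> W) (K : R) (T : Type)
    (F : set_system T) {FF : Filter F} (f : T -> V) l :
  (forall x y, rnorm (g x - g y) <= K * rnorm (x - y)) ->
  f @ F --> l -> (fun t => g (f t)) @ F --> g l.
Proof.
move=> gK /cvg_rnormP fl; apply/cvg_rnormP => e e0.
have K0 : 0 < `|K| + 1 by rewrite ltr_wpDl.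
have := fl (e / (`|K| + 1)); rewrite divr_gt0// => /(_ isT).
apply: filterS => t; rewrite ltr_pdivlMr// => h.
rewrite (le_lt_trans (gK _ _))// (le_lt_trans _ h)// mulrC ler_wpM2l ?rnorm_ge0//.
by rewrite (le_trans (ler_norm K))// lerDl.
Qed.

End RealNorm.

(** * The underlying real inner product and operator arithmetic *)

Section RealInner.
Context {R : realType} {H : hilbertType R}.
Local Open Scope complex_scope.
Implicit Types (x y z : H) (T S : bop H).

Definition rinner x y : R := complex.Re (inner x y).

Lemma rinner_rnorm x : rinner x x = rnorm x ^+ 2.
Proof. by rewrite /rinner inner_norm rnormE !expr2 -rmorphM. Qed.

Lemma rinnerC x y : rinner x y = rinner y x.
Proof. by rewrite /rinner (inner_conj x y); case: (inner x y). Qed.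

Lemma inner0l y : inner 0 y = 0.
Proof.
have := inner_linearl 1 0 0 y; rewrite scaler0 addr0 mul1r => /eqP.
by rewrite -subr_eq0 opprD addrA subrr add0r oppr_eq0 => /eqP.
Qed.

Lemma innerZl k x y : inner (k *: x) y = k * inner x y.
Proof. by have := inner_linearl k x 0 y; rewrite addr0 inner0l addr0. Qed.

Lemma rinnerDl x y z : rinner (x + y) z = rinner x z + rinner y z.
Proof.
have := inner_linearl 1 x y z; rewrite scale1r mul1r /rinner => ->.
by case: (inner x z); case: (inner y z).
Qed.

Lemma rinnerZl (k : R) x y : rinner (k%:C *: x) y = k * rinner x y.
Proof. by rewrite /rinner innerZl; case: (inner x y) => a b /=; rewrite mul0r subr0. Qed.

Lemma rinnerNl x y : rinner (- x) y = - rinner x y.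
Proof. by rewrite -scaleN1r -[X in X *: _](rmorphN1 (real_complex R)) rinnerZl mulN1r. Qed.

Lemma rinner0l y : rinner 0 y = 0.
Proof. by rewrite /rinner inner0l. Qed.

Lemma rinnerDr x y z : rinner x (y + z) = rinner x y + rinner x z.
Proof. by rewrite rinnerC rinnerDl !(rinnerC x). Qed.

Lemma rinnerZr (k : R) x y : rinner x (k%:C *: y) = k * rinner x y.
Proof. by rewrite rinnerC rinnerZl rinnerC. Qed.

Lemma rinnerNr x y : rinner x (- y) = - rinner x y.
Proof. by rewrite rinnerC rinnerNl rinnerC. Qed.

Lemma rinner0r x : rinner x 0 = 0.
Proof. by rewrite rinnerC rinner0l. Qed.

Lemma rinnerBl x y z : rinner (x - y) z = rinner x z - rinner y z.
Proof. by rewrite rinnerDl rinnerNl. Qed.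

Lemma rinnerBr x y z : rinner x (y - z) = rinner x y - rinner x z.
Proof. by rewrite rinnerDr rinnerNr. Qed.

Lemma rinner_conjZ (k : R[i]) x y : rinner (k *: x) y = rinner x (k^* *: y).
Proof.
rewrite [RHS]rinnerC /rinner !innerZl (inner_conj x y); case: k => a b.
by case: (inner x y) => c d /=; rewrite mulrNN.
Qed.

Lemma rinner_conjZr (k : R[i]) x y : rinner x (k *: y) = rinner (k^* *: x) y.
Proof. by rewrite rinner_conjZ conjCK. Qed.

Lemma rinner_suml (I : Type) (r : seq I) (f : I -> H) y :
  rinner (\sum_(i <- r) f i) y = \sum_(i <- r) rinner (f i) y.
Proof.
by elim/big_ind2: _ => [|x1 x2 y1 y2 <- <-|//]; rewrite ?rinner0l ?rinnerDl.
Qed.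

Lemma rinner_ext x y : (forall z, rinner z x = rinner z y) -> x = y.
Proof.
move=> xy; apply/eqP; rewrite -subr_eq0; apply/eqP/rnorm_eq0/eqP.
by rewrite -sqrf_eq0 -rinner_rnorm rinnerBr xy subrr.
Qed.

Lemma rnorm_sqrD x y : rnorm (x + y) ^+ 2 = rnorm x ^+ 2 + 2 * rinner x y + rnorm y ^+ 2.
Proof. by rewrite -!rinner_rnorm !(rinnerDl, rinnerDr) (rinnerC y x); ring. Qed.

Lemma rnorm_sqrB x y : rnorm (x - y) ^+ 2 = rnorm x ^+ 2 - 2 * rinner x y + rnorm y ^+ 2.
Proof. by rewrite rnorm_sqrD rinnerNr rnormN; ring. Qed.

Lemma rinner_le x y : rinner x y <= rnorm x * rnorm y.
Proof.
have [x0|x0] := eqVneq (rnorm x) 0; first by rewrite (rnorm_eq0 x0) rinner0l rnorm0 mul0r.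
have [y0|y0] := eqVneq (rnorm y) 0; first by rewrite (rnorm_eq0 y0) rinner0r rnorm0 mulr0.
have xy0 : 0 < rnorm x * rnorm y by rewrite lt_def mulf_neq0// mulr_ge0// rnorm_ge0.
have := sqr_ge0 (rnorm ((rnorm y)%:C *: x - (rnorm x)%:C *: y)).
rewrite rnorm_sqrB rinnerZl rinnerZr !rnormZr !ger0_norm ?rnorm_ge0// => h.
rewrite -(ler_pM2l xy0); nra.
Qed.

(** [k = 1] compares the real parts and [k = - 'i] the imaginary parts. *)
Lemma inner_rinner x y x' y' : (forall k : R[i], rinner (k *: x) y = rinner (k *: x') y') ->
  inner x y = inner x' y'.
Proof.
move=> h; have := h 1; have := h (- 'i); rewrite /rinner !innerZl !mul1r.
case: (inner x y) (inner x' y') => a b [c d] /=.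
by rewrite !oppr0 !mul0r !sub0r !mulNr !opprK !mul1r => -> ->.
Qed.

Lemma le_opnorm T x : rnorm (T x) <= opnorm T * rnorm x.
Proof. by rewrite -lecR rmorphM/= -!rnormE opnormP. Qed.

Lemma rnorm_opnorm T : rnorm T = opnorm T.
Proof. by []. Qed.

Lemma opnormD S T : opnorm (S + T) <= opnorm S + opnorm T.
Proof. exact: (@rnormD _ (bop H)). Qed.

Lemma opnormN T : opnorm (- T) = opnorm T.
Proof. exact: (@rnormN _ (bop H)). Qed.

Lemma opnorm_leP T (K : R) : 0 <= K -> (forall x, rnorm (T x) <= K * rnorm x) -> opnorm T <= K.
Proof.
move=> K0 TK; apply: opnorm_le => x; rewrite !rnormE !lecR => x1.
by rewrite (le_trans (TK x))// ler_piMr// -lecR -rnormE.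
Qed.

Lemma opnorm_mul S T : opnorm (S * T) <= opnorm S * opnorm T.
Proof.
apply: opnorm_leP => [|x]; first by rewrite mulr_ge0// opnorm_ge0.
by rewrite bop_mulE -mulrA (le_trans (le_opnorm _ _))// ler_wpM2l ?opnorm_ge0// le_opnorm.
Qed.

Lemma opD T x y : T (x + y) = T x + T y.
Proof. by have := bop_linear T 1 x y; rewrite !scale1r. Qed.

Lemma opN T x : T (- x) = - T x.
Proof. by rewrite -scaleN1r bopZ scaleN1r. Qed.

Lemma opB T x y : T (x - y) = T x - T y.
Proof. by rewrite opD opN. Qed.

Lemma op_sum T (I : Type) (r : seq I) (f : I -> H) :
  T (\sum_(i <- r) f i) = \sum_(i <- r) T (f i).
Proof. by elim/big_ind2: _ => [|x1 x2 y1 y2 <- <-|//]; rewrite ?bop0 ?opD. Qed.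

Lemma sum_opE (I : Type) (r : seq I) (f : I -> bop H) x :
  (\sum_(i <- r) f i) x = \sum_(i <- r) f i x.
Proof. by elim/big_ind2: _ => [|x1 x2 y1 y2 <- <-|]. Qed.

Lemma opp_opE T x : (- T) x = - T x.
Proof. by []. Qed.

Lemma scale_opAl (k : R[i]) S T : k *: (S * T) = (k *: S) * T.
Proof. exact: bopP. Qed.

Lemma scale_opAr (k : R[i]) S T : k *: (S * T) = S * (k *: T).
Proof. by apply: bopP => x; rewrite bop_scaleE !bop_mulE bop_scaleE bopZ. Qed.

Lemma bounded_op (f : H -> H) (K : R) : linear f ->
  (forall x, rnorm (f x) <= K * rnorm x) -> {T : bop H | T =1 f}.
Proof.
move=> fl fK; suff fb : f \in @bounded_linear R H by exists (Bop fb).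
apply/bounded_linearP; split => //; exists K => x.
by rewrite !rnormE -rmorphM lecR.
Qed.

End RealInner.

(** * Riesz representation of real functionals *)

Section Riesz.
Context {R : realType} {H : hilbertType R}.
Local Open Scope complex_scope.
Implicit Types (x y z h : H).

(* compare the values of [rnorm x ^+ 2 - 2 * g x] at [x] and [x + (a / b) *: h]   *)
Lemma approx_minimiser_defect (g : H -> R) (j d : R) x h :
  (forall x y, g (x + y) = g x + g y) ->
  (forall (k : R) x, g (k%:C *: x) = k * g x) ->
  (forall x, j <= rnorm x ^+ 2 - 2 * g x) ->
  rnorm x ^+ 2 - 2 * g x <= j + d ->
  (g h - rinner x h) ^+ 2 <= d * (rnorm h ^+ 2 + 1).
Proof.
move=> gD gZ gj xd; set a := g h - rinner x h; set b := rnorm h ^+ 2 + 1.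
have b1 : 1 <= b by rewrite lerDr sqr_ge0.
have b0 : 0 < b by rewrite (lt_le_trans _ b1).
have := gj (x + (a / b)%:C *: h).
rewrite gD gZ rnorm_sqrD rinnerZr rnormZr exprMn real_normK ?num_real// => le.
set s := a / b in le.
have as_ : a = s * b by rewrite mulfVK// gt_eqF.
have gE : g h = a + rinner x h by rewrite /a subrK.
have hb : rnorm h ^+ 2 = b - 1 by rewrite /b addrK.
rewrite gE hb as_ in le; rewrite as_; clearbody s b.
have -> : (s * b) ^+ 2 = s ^+ 2 * b * b by ring.
by rewrite ler_pM2r//; have := sqr_ge0 s; lra.
Qed.

(** The functional |x|^2 - 2 g(x) is bounded below by - M^2 because (|x| - M)^2 >= 0. Its minimising
    sequences converge, and the limit represents [g] since the first variation vanishes in every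
    direction. *)
Lemma riesz (g : H -> R) (M : R) :
  (forall x y, g (x + y) = g x + g y) ->
  (forall (k : R) x, g (k%:C *: x) = k * g x) ->
  (forall x, g x <= M * rnorm x) ->
  exists y, forall x, g x = rinner x y.
Proof.
move=> gD gZ gM; pose J x := rnorm x ^+ 2 - 2 * g x.
have Jlb : lbound (range J) (- M ^+ 2).
  move=> _ [x _ <-]; rewrite /J; have := gM x; have := sqr_ge0 (rnorm x - M); nra.
have Jinf : has_inf (range J) by split; [exists (J 0), 0 | exists (- M ^+ 2)].
set j := inf (range J).
have jJ x : j <= J x by apply: ge_inf; [case: Jinf | exists x].
have /choice[u uj] (n : nat) : exists x, J x <= j + n.+1%:R^-1.
  have n0 : 0 < n.+1%:R^-1 :> R by rewrite invr_gt0.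
  by have [_ [x _ <-] /ltW xj] := inf_adherent n0 Jinf; exists x.
have inv_small (e : R) : 0 < e -> exists N, forall n, (N <= n)%N -> n.+1%:R^-1 < e.
  by move=> e0; have [N _ NP] := near_infty_natSinv_lt (PosNum e0); exists N.
have defect (n : nat) h := approx_minimiser_defect h gD gZ jJ (uj n).
have /cvg_ex[y uy] : cvgn u.
  apply: cauchy_seq_cvg => e e0.
  have [N NP] := inv_small (e ^+ 2 / 4) (divr_gt0 (exprn_gt0 _ e0) (ltr0n _ 4)).
  exists N => m n Nm mn; have Nn := leq_trans Nm mn.
  (* The value at the midpoint is at least [j], so the parallelogram law gives |u_n - u_m|^2 <= 2
     (dm + dn), where both excesses over [j] are below e^2 / 4. *)
  have := jJ (2^-1%:C *: (u m + u n)); rewrite /J gZ gD rnormZr ger0_norm// exprMn.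
  move: (uj m) (uj n) (NP m Nm) (NP n Nn); rewrite /J.
  have := rnorm_sqrD (u m) (u n); have := rnorm_sqrB (u n) (u m); rewrite (rinnerC (u n)).
  move=> eB -> um un im in_ le.
  rewrite -(ltr_pXn2r (n := 2)) ?nnegrE ?rnorm_ge0// ?ltW// eB.
  have q : 2^-1 ^+ 2 = 4^-1 :> R by rewrite exprVn -natrX.
  rewrite q in le; move: (m.+1%:R^-1) (n.+1%:R^-1) um un im in_ => dm dn *; lra.
exists y => h; apply/eqP; rewrite (rinnerC h) -subr_eq0; apply/negPn/negP.
set D := g h - rinner y h => D0.
set K := rnorm h + 1; have K0 : 0 < K by rewrite ltr_wpDl// rnorm_ge0.
have D'0 : 0 < `|D| by rewrite normr_gt0.
(* Two errors, one from the near-minimiser and one from the limit, are each at most e K = |D| / 4,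
   which contradicts D <> 0. *)
set e := `|D| / (4 * K); have e0 : 0 < e by rewrite divr_gt0// mulr_gt0.
have eK0 : 0 <= e * K by rewrite mulr_ge0// ltW.
have [N1 N1P] := inv_small (e ^+ 2) (exprn_gt0 _ e0).
have /cvg_seq_rnormP/(_ _ e0)[N2 N2P] := uy.
set n := maxn N1 N2.
have n1 := ltW (N1P n (leq_maxl _ _)); have n2 := ltW (N2P n (leq_maxr _ _)).
have d1 : `|g h - rinner (u n) h| <= e * K.
  rewrite -(ler_pXn2r (n := 2)) ?nnegrE// real_normK ?num_real//.
  rewrite (le_trans (defect n h))// exprMn ler_pM// ?addr_ge0 ?sqr_ge0 ?invr_ge0//.
  rewrite /K; have := rnorm_ge0 h; nra.
have d2 : `|rinner (u n) h - rinner y h| <= e * K.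
  have e1 : rnorm (u n - y) * rnorm h <= e * K.
    by rewrite ler_pM ?rnorm_ge0 ?lerDl// rnormC.
  rewrite ler_norml -rinnerBl (le_trans (rinner_le _ _) e1) andbT lerNl -rinnerNl.
  by rewrite (le_trans (rinner_le _ _))// rnormN.
have : `|D| <= 2 * (e * K).
  rewrite /D -(subrKA (rinner (u n) h)) (le_trans (ler_normD _ _))//.
  by rewrite mulr2n mulrDl mul1r lerD.
have eK : e * K = `|D| / 4 by rewrite /e invfM mulrA mulfVK// gt_eqF.
rewrite eK; lra.
Qed.

End Riesz.

(** * Adjoints *)

Section Adjoint.
Context {R : realType} {H : hilbertType R}.
Local Open Scope complex_scope.
Implicit Types (x y z : H) (S T : bop H).

(** Riesz applies to [x |-> rinner (T x) y] for each [y]. The chosen vectors depend linearly on [y]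
    because inner products determine them, and boundedly by testing each on itself. *)
Lemma adj_exists T : exists S, forall x y, rinner (T x) y = rinner x (S y).
Proof.
have /choice[f fP] (y : H) : exists z, forall x, rinner (T x) y = rinner x z.
  apply: (@riesz _ _ (fun x => rinner (T x) y) (opnorm T * rnorm y)).
  - by move=> x x'; rewrite opD rinnerDl.
  - by move=> k x; rewrite bopZ rinnerZl.
  - by move=> x; rewrite (le_trans (rinner_le _ _))// mulrAC ler_wpM2r ?rnorm_ge0 ?le_opnorm.
have fl : linear f.
  move=> k y z; apply: rinner_ext => x.
  by rewrite -fP !rinnerDr (fP z) rinner_conjZr -bopZ fP -rinner_conjZr.
have [S SP] : {S : bop H | S =1 f}.
  apply: (@bounded_op _ _ f (opnorm T)) => // y.
  have [->|y0] := eqVneq (f y) 0; first by rewrite rnorm0 mulr_ge0 ?opnorm_ge0 ?rnorm_ge0.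
  have fy0 : 0 < rnorm (f y) by rewrite lt_def rnorm_ge0 andbT; apply: contra_neq y0; exact: rnorm_eq0.
  rewrite -(ler_pM2l fy0) -expr2 -rinner_rnorm -fP (le_trans (rinner_le _ _))//.
  by rewrite mulrA ler_wpM2r ?rnorm_ge0// mulrC le_opnorm.
by exists S => x y; rewrite SP.
Qed.

(** [adj] is selected through the complex inner product; the real identity suffices because [x] runs
    through all its complex multiples. *)
Lemma adj_unique T S : (forall x y, rinner (T x) y = rinner x (S y)) -> adj T = S.
Proof.
move=> TS; have TS' x y : inner (T x) y = inner x (S y).
  by apply: inner_rinner => k; rewrite -bopZ TS.
apply: xget_unique => // S' S'P; apply: bopP => y; apply: rinner_ext => x.
by rewrite /rinner -S'P TS'.
Qed.

Lemma adjP T x y : rinner (T x) y = rinner x (adj T y).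
Proof. by have [S SP] := adj_exists T; rewrite (adj_unique SP). Qed.

Lemma adjK T : adj (adj T) = T.
Proof. by apply: adj_unique => x y; rewrite rinnerC -adjP rinnerC. Qed.

Lemma adjM S T : adj (S * T) = adj T * adj S.
Proof. by apply: adj_unique => x y; rewrite !bop_mulE !adjP. Qed.

Lemma adjD S T : adj (S + T) = adj S + adj T.
Proof. by apply: adj_unique => x y; rewrite !bop_addE rinnerDl rinnerDr !adjP. Qed.

Lemma adjZ (k : R[i]) T : adj (k *: T) = k^* *: adj T.
Proof. by apply: adj_unique => x y; rewrite !bop_scaleE rinner_conjZ adjP bopZ. Qed.

Lemma adjB S T : adj (S - T) = adj S - adj T.
Proof. by apply: adj_unique => x y; rewrite !bop_addE !opp_opE rinnerBl rinnerBr !adjP. Qed.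

Lemma adj0 : adj 0 = 0 :> bop H.
Proof. by rewrite -[0 in LHS](subrr 0) adjB subrr. Qed.

Lemma adj1 : adj 1 = 1 :> bop H.
Proof. by apply: adj_unique. Qed.

Lemma adj_sum (I : Type) (r : seq I) (f : I -> bop H) :
  adj (\sum_(i <- r) f i) = \sum_(i <- r) adj (f i).
Proof. by elim/big_ind2: _ => [|x1 x2 y1 y2 <- <-|]; rewrite ?adj0 ?adjD. Qed.

Lemma rnorm_sqr_adj T x : rnorm (adj T x) ^+ 2 = rinner (T (adj T x)) x.
Proof. by rewrite adjP rinner_rnorm. Qed.

Lemma opnorm_adj_le T : opnorm (adj T) <= opnorm T.
Proof.
apply: opnorm_leP => [|x]; first exact: opnorm_ge0.
have [->|y0] := eqVneq (adj T x) 0; first by rewrite rnorm0 mulr_ge0 ?opnorm_ge0 ?rnorm_ge0.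
have fy0 : 0 < rnorm (adj T x) by rewrite lt_def rnorm_ge0 andbT; apply: contra_neq y0; exact: rnorm_eq0.
rewrite -(ler_pM2l fy0) -expr2 rnorm_sqr_adj (le_trans (rinner_le _ _))//.
by rewrite mulrA ler_wpM2r ?rnorm_ge0// mulrC le_opnorm.
Qed.

Lemma opnorm_adj T : opnorm (adj T) = opnorm T.
Proof. by apply/eqP; rewrite eq_le opnorm_adj_le -{1}(adjK T) opnorm_adj_le. Qed.

End Adjoint.

(** * Strong and norm limits of operators *)

Section OperatorLimits.
Context {R : realType} {H : hilbertType R}.
Local Open Scope complex_scope.
Implicit Types (x y z : H) (S T : bop H).

(** Stated for any proper filter, so as to serve both partial sums and approximate units. The
    pointwise limit inherits linearity and the bound. *)
Lemma op_limit (I : Type) (F : set_system I) {FF : ProperFilter F}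
    (u : I -> bop H) (K : R) : 0 <= K ->
  (\forall i \near F, opnorm (u i) <= K) ->
  (forall x, cvg ((fun i => u i x) @ F)) ->
  exists T : bop H, (forall x, (fun i => u i x) @ F --> T x) /\ opnorm T <= K.
Proof.
move=> K0 uK uc; pose f x := lim ((fun i => u i x) @ F).
have fl : linear f.
  move=> k x y; apply: (@cvg_rnorm_unique _ _ _ F _ (fun i => u i (k *: x + y))).
    exact: (uc (k *: x + y)).
  rewrite [X in X @ _ --> _](_ : _ = (k \*: (fun i => u i x)) + (fun i => u i y)).
    by apply: cvgD; [apply: cvgZl_tmp; exact: uc | exact: uc].
  by apply/funext => i; rewrite bop_linear.
have fK x : rnorm (f x) <= K * rnorm x.
  apply: (cvg_rnorm_le (uc x)); apply: filterS uK => i uiK.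
  by rewrite (le_trans (le_opnorm _ _))// ler_wpM2r// rnorm_ge0.
have [T TP] := bounded_op fl fK; exists T; split=> [x|].
  by rewrite TP; exact: uc.
by apply: opnorm_leP => // x; rewrite TP.
Qed.

(** Completeness of [H] gives the pointwise limit; letting the larger index grow in the Cauchy
    estimate at each vector turns it into a norm limit. *)
Lemma bop_cauchy_cvg (u : nat -> bop H) :
  (forall e : R, 0 < e -> exists N, forall m n, (N <= m)%N -> (m <= n)%N ->
    opnorm (u n - u m) <= e) -> cvgn u.
Proof.
move=> uC.
have uxC x : cvgn (fun n => u n x).
  apply: cauchy_seq_cvg => e e0.
  have x0 : 0 < rnorm x + 1 by rewrite ltr_wpDl// rnorm_ge0.
  have /uC[N NP] : 0 < e / (rnorm x + 1) by rewrite divr_gt0.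
  exists N => m n Nm mn; rewrite (le_lt_trans (le_opnorm (u n - u m) x))//.
  rewrite (@le_lt_trans _ _ (e / (rnorm x + 1) * rnorm x))//.
    by rewrite ler_wpM2r ?rnorm_ge0 ?NP.
  by rewrite mulrAC ltr_pdivrMr// ltr_pM2l// ltrDl.
have [N1 N1P] := uC 1 ltr01.
have [||T [TP _]] := @op_limit _ \oo _ u (opnorm (u N1) + 1) _ _ uxC.
- by rewrite addr_ge0// opnorm_ge0.
- exists N1 => // n /= N1n; rewrite -(subrK (u N1) (u n)) addrC.
  by rewrite (le_trans (opnormD _ _))// lerD2l N1P.
apply/cvg_ex; exists T; apply/cvg_seq_rnormP => e e0.
have /uC[N NP] : 0 < e / 2 by rewrite divr_gt0.
exists N => n Nn; rewrite (@le_lt_trans _ _ (e / 2)) ?gtr_pMr ?invf_lt1 ?ltr1n//.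
apply: opnorm_leP => [|x]; first by rewrite ltW// divr_gt0.
have TuP : (fun m => u m x - u n x) @ \oo --> T x - u n x.
  apply: (cvg_lipschitz (g := fun y => y - u n x) (K := 1)) (TP x) => y z.
  by rewrite opprB addrA subrK mul1r.
apply: (cvg_rnorm_le TuP).
exists n => // m /= nm; rewrite (le_trans (le_opnorm (u m - u n) x))//.
by rewrite ler_wpM2r ?rnorm_ge0 ?NP.
Qed.

End OperatorLimits.

(** * Row operators and their quadratic forms *)

Section RowOperators.
Context {R : realType} {H : hilbertType R} {I : Type}.
Implicit Types (r : seq I) (a b : I -> bop H) (x y z : H).

(** The quadratic form of \sum_i a_i a_i^* at z. A bound by K |z|^2 stands for the operator
    inequality \sum_i a_i a_i^* <= K. *)
Definition sqsum r a z : R := \sum_(i <- r) rnorm (adj (a i) z) ^+ 2.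

Lemma sqsum_ge0 r a z : 0 <= sqsum r a z.
Proof. by apply: sumr_ge0 => i _; exact: sqr_ge0. Qed.

Lemma sqsum_rinner r a z :
  sqsum r a z = rinner ((\sum_(i <- r) a i * adj (a i)) z) z.
Proof.
rewrite sum_opE rinner_suml; apply: eq_bigr => i _.
by rewrite rnorm_sqr_adj.
Qed.

Lemma sqsum_opnorm r a z :
  sqsum r a z <= opnorm (\sum_(i <- r) a i * adj (a i)) * rnorm z ^+ 2.
Proof.
by rewrite sqsum_rinner (le_trans (rinner_le _ _))// expr2 mulrA ler_wpM2r ?rnorm_ge0// le_opnorm.
Qed.

(* expand [0 <= \sum_i rnorm (y i - k *: adj (a i) z) ^+ 2] at [z = \sum_i a i (y i)] *)
Lemma row_bound r a (y : I -> H) (K : R) : 0 <= K ->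
  (forall z, sqsum r a z <= K * rnorm z ^+ 2) ->
  rnorm (\sum_(i <- r) a i (y i)) ^+ 2 <= K * \sum_(i <- r) rnorm (y i) ^+ 2.
Proof.
move=> K0 aK; set z := \sum_(i <- r) _; set S := \sum_(i <- r) _.
have S0 : 0 <= S by apply: sumr_ge0 => i _; exact: sqr_ge0.
have zE : rnorm z ^+ 2 = \sum_(i <- r) rinner (y i) (adj (a i) z).
  by rewrite -rinner_rnorm {1}/z rinner_suml; apply: eq_bigr => i _; rewrite adjP.
have key (k : R) : 0 <= S - 2 * k * rnorm z ^+ 2 + k ^+ 2 * (K * rnorm z ^+ 2).
  apply: (@le_trans _ _ (\sum_(i <- r) rnorm (y i - (k%:C)%C *: adj (a i) z) ^+ 2)).
    by apply: sumr_ge0 => i _; exact: sqr_ge0.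
  rewrite (eq_bigr (fun i => rnorm (y i) ^+ 2 - 2 * k * rinner (y i) (adj (a i) z) +
    k ^+ 2 * rnorm (adj (a i) z) ^+ 2)).
    rewrite !big_split/= sumrN -!mulr_sumr -zE lerD2l.
    by rewrite ler_wpM2l ?sqr_ge0//; exact: aK.
  move=> i _; rewrite rnorm_sqrB rinnerZr rnormZr exprMn real_normK ?num_real//.
  by rewrite mulrA.
have [K00|Kn0] := eqVneq K 0.
  have [->|q0] := eqVneq (rnorm z ^+ 2) 0; first by rewrite mulr_ge0.
  have := key ((S + 1) / (2 * rnorm z ^+ 2)).
  rewrite K00 mul0r mulr0 addr0 mul0r -mulrA.
  have -> : 2 * ((S + 1) / (2 * rnorm z ^+ 2) * rnorm z ^+ 2) = S + 1 by field; rewrite -sqrf_eq0.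
  by rewrite opprD addrA subrr sub0r oppr_ge0 ler10.
have Kgt0 : 0 < K by rewrite lt_def Kn0.
have := key K^-1.
have -> : K^-1 ^+ 2 * (K * rnorm z ^+ 2) = K^-1 * rnorm z ^+ 2 by field.
by rewrite -(ler_pdivrMl _ _ Kgt0); lra.
Qed.

(** [row_bound] with y_i = b_i^* z: an operator Cauchy-Schwarz inequality that sees only the two
    quadratic forms. *)
Lemma opnorm_row_col r a b (K L : R) : 0 <= K -> 0 <= L ->
  (forall z, sqsum r a z <= K * rnorm z ^+ 2) ->
  (forall z, sqsum r b z <= L * rnorm z ^+ 2) ->
  opnorm (\sum_(i <- r) a i * adj (b i)) <= Num.sqrt K * Num.sqrt L.
Proof.
move=> K0 L0 aK bL; apply: opnorm_leP => [|z]; first by rewrite mulr_ge0 ?sqrtr_ge0.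
rewrite -(ler_pXn2r (n := 2)) ?nnegrE ?rnorm_ge0 ?mulr_ge0 ?sqrtr_ge0 ?rnorm_ge0//.
rewrite !exprMn !sqr_sqrtr// sum_opE (le_trans (row_bound _ K0 aK))//.
by rewrite -mulrA ler_wpM2l// bL.
Qed.

Lemma opnorm_sqsum r a (K : R) : 0 <= K ->
  (forall z, sqsum r a z <= K * rnorm z ^+ 2) ->
  opnorm (\sum_(i <- r) a i * adj (a i)) <= K.
Proof.
move=> K0 aK; rewrite (le_trans (opnorm_row_col K0 K0 aK aK))//.
by rewrite -expr2 sqr_sqrtr.
Qed.

End RowOperators.

(** * Powers of 1 - c for a positive contraction c *)

Section PositiveContraction.
Context {R : realType} {H : hilbertType R}.
Variable c : bop H.
Hypothesis c_adj : adj c = c.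
(** For selfadjoint [c] this reads c^2 <= c, that is 0 <= c <= 1. *)
Hypothesis c_contr : forall x, rnorm (c x) ^+ 2 <= rinner (c x) x.
Implicit Types x : H.
Let d : bop H := 1 - c.

Let cE : c = 1 - d. Proof. by rewrite /d opprB addrC subrK. Qed.

Let adj_d j : adj (d ^+ j) = d ^+ j.
Proof. by elim: j => [|j IH]; rewrite ?adj1// exprS adjM IH adjB adj1 c_adj -exprSr exprS. Qed.

Let d_sqr x : rnorm (d x) ^+ 2 <= rinner (d x) x.
Proof.
have -> : d x = x - c x by [].
by rewrite rnorm_sqrB rinnerBl rinner_rnorm (rinnerC x); have := c_contr x; lra.
Qed.

Let rnorm_d j x : rnorm ((d ^+ j) x) <= rnorm x.
Proof.
elim: j => [|j IH]; first by rewrite expr0.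
rewrite exprS bop_mulE (le_trans _ IH)//; set y := (d ^+ j) x.
rewrite -(ler_pXn2r (n := 2)) ?nnegrE ?rnorm_ge0//.
have -> : d y = y - c y by [].
by rewrite rnorm_sqrB (rinnerC y); have := c_contr y; have := sqr_ge0 (rnorm (c y)); lra.
Qed.

Let rinner_dd i j x : rinner ((d ^+ (i + j)) x) x = rinner ((d ^+ j) x) ((d ^+ i) x).
Proof. by rewrite exprD bop_mulE adjP adj_d. Qed.

(** An even power gives the square |d^i x|^2; an odd one gives the form of [d] at d^i x, which is
    nonnegative by [d_sqr]. *)
Let d_pos j x : 0 <= rinner ((d ^+ j) x) x.
Proof.
rewrite -(odd_double_half j) -addnn; case: (odd j) => /=.
  rewrite add1n -addSn rinner_dd exprS bop_mulE rinnerC.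
  by rewrite (le_trans _ (d_sqr _))// sqr_ge0.
by rewrite add0n rinner_dd rinner_rnorm sqr_ge0.
Qed.

Let cd j : c * d ^+ j = d ^+ j - d ^+ j.+1.
Proof. by rewrite cE mulrBl mul1r exprS. Qed.

Let cdC j : c * d ^+ j = d ^+ j * c.
Proof. by rewrite cd cE mulrBr mulr1 exprSr. Qed.

(* The numbers [rinner ((c * d ^+ j) x) x] decrease with [j], and their sum telescopes
   since [c * d ^+ j = d ^+ j - d ^+ j.+1]. *)
Lemma rinner_pow_le m x : m.+1%:R * rinner ((c * d ^+ m) x) x <= rnorm x ^+ 2.
Proof.
suff : m.+1%:R * rinner ((c * d ^+ m) x) x <= rnorm x ^+ 2 - rinner ((d ^+ m.+1) x) x.
  by move=> /le_trans; apply; rewrite lerBlDr lerDl d_pos.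
have gE j : rinner ((c * d ^+ j) x) x = rinner ((d ^+ j) x) x - rinner ((d ^+ j.+1) x) x.
  by rewrite cd bop_addE opp_opE rinnerBl.
have g_decr j : rinner ((c * d ^+ j.+1) x) x <= rinner ((c * d ^+ j) x) x.
  rewrite -subr_ge0 -rinnerBl.
  have -> : (c * d ^+ j) x - (c * d ^+ j.+1) x = (c * d ^+ j * c) x.
    rewrite -opp_opE -bop_addE; congr (bop_fun _ x).
    by rewrite exprSr mulrA -[X in X - _]mulr1 -mulrBr -cE.
  by rewrite -mulrA bop_mulE adjP c_adj bop_mulE d_pos.
elim: m => [|m IH]; first by rewrite mul1r gE expr0 rinner_rnorm.
have -> : m.+2%:R = m.+1%:R + 1 :> R by rewrite natr1.
rewrite mulrDl mul1r.
have : m.+1%:R * rinner ((c * d ^+ m.+1) x) x <= m.+1%:R * rinner ((c * d ^+ m) x) x.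
  by rewrite ler_wpM2l.
by move=> /le_trans/(_ IH); have := gE m.+1; lra.
Qed.

(** Half of the power d^(2k) moves to the other side of the inner product, so the decay becomes a
    statement on the form of [c] at d^k x. *)
Lemma rinner_pow_double_le k x :
  (k.*2).+1%:R * rinner (c ((d ^+ k) x)) ((d ^+ k) x) <= rnorm x ^+ 2.
Proof.
have := rinner_pow_le k.*2 x; rewrite -addnn exprD mulrA cdC -mulrA bop_mulE adjP.
by rewrite adj_d.
Qed.

(** For D = d^i, evenness gives |x - D^2 x|^2 = |x|^2 - 2 |D x|^2 + |D^2 x|^2, and |D^2 x| <= |D
    x|. *)
Lemma opnorm_subr_pow i : opnorm (1 - d ^+ i.*2) <= 1.
Proof.
apply: opnorm_leP => // x; rewrite mul1r.
rewrite -(ler_pXn2r (n := 2)) ?nnegrE ?rnorm_ge0//.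
have -> : (1 - d ^+ i.*2) x = x - (d ^+ i.*2) x by [].
rewrite rnorm_sqrB (rinnerC x) -addnn rinner_dd rinner_rnorm.
have : rnorm ((d ^+ (i + i)) x) ^+ 2 <= rnorm ((d ^+ i) x) ^+ 2.
  by rewrite exprD bop_mulE ler_pXn2r ?nnegrE ?rnorm_ge0.
have := sqr_ge0 (rnorm ((d ^+ i) x)); lra.
Qed.

Lemma adj_subr_pow k : adj (1 - d ^+ k) = 1 - d ^+ k.
Proof. by rewrite adjB adj1 adj_d. Qed.

End PositiveContraction.

(** * Approximate units for finite subsets of A *)

Section ApproximateUnit.
Context {R : realType} {H : hilbertType R}.
Variable A : set (bop H).
Hypothesis A_Cstar : Cstar_algebra A.
Implicit Types (a b : bop H) (r : seq (bop H)).

Lemma Cstar0 : A 0. Proof. by case: A_Cstar. Qed.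

Lemma CstarZD (k : R[i]) a b : A a -> A b -> A (k *: a + b).
Proof. by case: A_Cstar => _ h _ _ _; exact: h. Qed.

Lemma CstarM a b : A a -> A b -> A (a * b).
Proof. by case: A_Cstar => _ _ h _ _; exact: h. Qed.

Lemma Cstar_adj a : A a -> A (adj a).
Proof. by case: A_Cstar => _ _ _ h _; exact: h. Qed.

Lemma Cstar_closed : closed A.
Proof. by case: A_Cstar. Qed.

Lemma CstarD a b : A a -> A b -> A (a + b).
Proof. by move=> Aa Ab; rewrite -[a]scale1r; exact: CstarZD. Qed.

Lemma CstarZ (k : R[i]) a : A a -> A (k *: a).
Proof. by move=> Aa; rewrite -[_ *: _]addr0; apply: CstarZD => //; exact: Cstar0. Qed.

Lemma CstarB a b : A a -> A b -> A (a - b).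
Proof. by move=> Aa Ab; rewrite addrC -scaleN1r; exact: CstarZD. Qed.

Lemma Cstar_sum (I : eqType) (s : seq I) (f : I -> bop H) :
  (forall i, i \in s -> A (f i)) -> A (\sum_(i <- s) f i).
Proof.
by move=> Af; rewrite big_seq; apply: big_ind => //; [exact: Cstar0|exact: CstarD].
Qed.

(** The form of [c] dominates l |a^* x|^2 for all listed a simultaneously. Its decay at d^k x
    therefore makes a^* d^k small, and the adjoint of a^* d^k is d^k a = a - u a. *)
Lemma approximate_unit r (e : R) : (forall a, a \in r -> A a) -> 0 < e ->
  exists u, [/\ A u, adj u = u, opnorm u <= 1 &
    forall a, a \in r -> opnorm (u * a - a) < e].
Proof.
move=> Ar e0; pose S := \sum_(a <- r) opnorm a ^+ 2.
have S0 : 0 <= S by apply: sumr_ge0 => a _; exact: sqr_ge0.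
(* [row_bound] gives s^2 <= S s, so l S <= 1 makes c = l s a positive contraction; the added 1
   covers S = 0. *)
pose l := (S + 1)^-1; have l0 : 0 < l by rewrite invr_gt0 ltr_wpDl.
pose s := \sum_(a <- r) a * adj a; pose c := (l%:C)%C *: s.
have cx x : c x = (l%:C)%C *: s x by [].
have rinner_c x : rinner (c x) x = l * sqsum r id x by rewrite cx rinnerZl sqsum_rinner.
have c_adj : adj c = c.
  rewrite /c adjZ adj_sum.
  rewrite (eq_bigr (fun a => a * adj a)) => [|a _]; last by rewrite adjM adjK.
  by congr (_ *: _); exact: conjc_real.
have c_contr x : rnorm (c x) ^+ 2 <= rinner (c x) x.
  rewrite rinner_c cx rnormZr (ger0_norm (ltW l0)) exprMn expr2 -mulrA ler_pM2l//.
  have sS z : sqsum r id z <= S * rnorm z ^+ 2.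
    rewrite /sqsum /S mulr_suml; apply: ler_sum => a _.
    by rewrite -exprMn -(opnorm_adj a) ler_pXn2r ?nnegrE ?mulr_ge0 ?opnorm_ge0 ?rnorm_ge0 ?le_opnorm.
  rewrite sum_opE (le_trans (ler_wpM2l (ltW l0) (row_bound _ S0 sS)))//.
  rewrite mulrA ler_piMl ?sqsum_ge0// /l mulrC ler_pdivrMr ?ltr_wpDl// mul1r.
  by rewrite lerDl.
have le2 : 0 < l * e ^+ 2 by rewrite mulr_gt0// exprn_gt0.
(* The final error is the root of 1 / (l (2k + 1)). With k = 2i it is below e once 1 / (i + 1) < l
   e^2. *)
have [i _ iP] := near_infty_natSinv_lt (PosNum le2).
pose d := 1 - c; pose k := i.*2; exists (1 - d ^+ k).
have Ac : A c by apply/CstarZ/Cstar_sum => a /Ar Aa; apply: CstarM => //; exact: Cstar_adj.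
split.
(* 1 need not be in [A]; the recursion builds 1 - d^(k+1) from [c] and 1 - d^k alone. *)
- elim: k => [|k IH]; first by rewrite expr0 subrr; exact: Cstar0.
  have -> : 1 - d ^+ k.+1 = (1 - d ^+ k) + c - (1 - d ^+ k) * c.
    rewrite exprSr {2}/d mulrBr mulr1 opprB addrA addrAC; rewrite -[RHS]addrA; congr (_ + _).
    by rewrite mulrBl mul1r opprB addrC subrK.
  by apply: CstarB; [exact: CstarD|exact: CstarM].
- exact: adj_subr_pow.
- exact: opnorm_subr_pow.
move=> a ar; rewrite mulrBl mul1r addrAC subrr sub0r opnormN.
have dk : adj (d ^+ k) = d ^+ k.
  apply/eqP; rewrite -(inj_eq (@oppr_inj _)) -(inj_eq (addrI 1)).
  by rewrite -(adj_subr_pow c_adj) adjB adj1.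
rewrite -opnorm_adj adjM dk.
have e1 : Num.sqrt (l * (k.*2).+1%:R)^-1 < e.
  rewrite -[ltRHS]ger0_norm ?ltW// -sqrtr_sqr ltr_sqrt ?exprn_gt0//.
  rewrite invfM mulrC ltr_pdivrMr// mulrC (le_lt_trans _ (iP _ (leqnn i)))//.
  by rewrite lef_pV2 ?posrE// ler_nat /k -!addnn ltnS; lia.
rewrite (le_lt_trans _ e1)//; apply: opnorm_leP; first exact: sqrtr_ge0.
move=> x; rewrite -(ler_pXn2r (n := 2)) ?nnegrE ?mulr_ge0 ?sqrtr_ge0 ?rnorm_ge0//.
rewrite exprMn sqr_sqrtr ?invr_ge0 ?mulr_ge0 ?(ltW l0)//.
rewrite [leRHS]mulrC ler_pdivlMr ?mulr_gt0//.
have := rinner_pow_double_le c_adj c_contr k x; rewrite rinner_c -/d.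
apply: le_trans; rewrite [leRHS]mulrCA mulrC -mulrA ler_pM2l// ler_wpM2l//.
(* Of the sum over the list only the term of [a] is kept. *)
rewrite /sqsum (perm_big _ (perm_to_rem ar)) big_cons bop_mulE lerDl.
by apply: sumr_ge0 => b _; exact: sqr_ge0.
Qed.

End ApproximateUnit.

(** * The filter of approximate units and nondegeneracy *)

Section UnitFilter.
Context {R : realType} {H : hilbertType R}.
Variable A : set (bop H).
Hypothesis A_Cstar : Cstar_algebra A.
Implicit Types (a b t T : bop H) (x y z : H).

(** The approximate unit as a filter on the operators themselves: a finite list and a tolerance
    index a tail set, so limits are taken in u directly. *)
Definition unit_filter : set_system (bop H) :=
  filter_from [set p : seq (bop H) * R | (forall a, a \in p.1 -> A a) /\ 0 < p.2]
    (fun p => [set u | [/\ A u, adj u = u, opnorm u <= 1 &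
       forall a, a \in p.1 -> opnorm (u * a - a) < p.2]]).

Lemma unit_filter_proper : ProperFilter unit_filter.
Proof.
apply: filter_from_proper => [|[r e] [/= Ar e0]]; last first.
  by have [u uP] := approximate_unit A_Cstar Ar e0; exists u.
apply: filter_from_filter; first by exists ([::], 1).
move=> [r e] [s f] [/= Ar e0] [/= As f0].
exists (r ++ s, Num.min e f) => /=.
  split; last by rewrite lt_min e0.
  by move=> a; rewrite mem_cat => /orP[/Ar|/As].
move=> u /= [Au uu u1 urs]; split; split=> // a ar.
  by have := urs a; rewrite mem_cat ar => /(_ isT); rewrite lt_min => /andP[].
by have := urs a; rewrite mem_cat ar orbT => /(_ isT); rewrite lt_min => /andP[].
Qed.
#[local] Existing Instance unit_filter_proper.

Lemma near_unit : \forall u \near unit_filter, [/\ A u, adj u = u & opnorm u <= 1].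
Proof. by exists ([::], 1) => //= u []. Qed.

Lemma unit_mul_cvg a : A a -> (fun u => u * a) @ unit_filter --> a.
Proof.
move=> Aa; apply/cvg_rnormP => e e0.
exists ([:: a], e) => /=; first by split=> // b; rewrite inE => /eqP ->.
by move=> u /= [_ _ _ /(_ a)]; rewrite inE eqxx rnormC; exact.
Qed.

Hypothesis A_nondegenerate : acts_nondegenerately A.

Lemma nondegenerate_dense z (e : R) : 0 < e ->
  exists n (a : 'I_n -> bop H) (x : 'I_n -> H),
    (forall i, A (a i)) /\ rnorm (z - \sum_(i < n) a i (x i)) < e.
Proof.
move=> e0; have : closure [set y : H | exists n (a : 'I_n -> bop H) (x : 'I_n -> H),
    (forall i, A (a i)) /\ y = \sum_(i < n) a i (x i)] z by rewrite A_nondegenerate.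
move=> /(_ (ball z (e%:C)%C)) [|_ [[n [a [x [Aa ->]]]] zy]].
  by apply: nbhsx_ballx; rewrite ltcR.
exists n, a, x; split => //; move: zy.
by rewrite -ball_normE/= rnormE ltcR.
Qed.

(** A uniformly bounded family that converges on the vectors a x converges on their span, hence, by
    density and the uniform bound, at every vector. *)
Lemma nondegenerate_cauchy (u : bop H -> bop H) (K : R) :
  (\forall i \near unit_filter, opnorm (u i) <= K) ->
  (forall a x, A a -> cvg ((fun i => u i (a x)) @ unit_filter)) ->
  forall z, cvg ((fun i => u i z) @ unit_filter).
Proof.
move=> uK ua z; apply: cauchy_rnorm_cvg => e e0.
have K0 : 0 <= K.
  by have [i iK] := filter_ex uK; rewrite (le_trans _ iK)// opnorm_ge0.
(* Chosen so that K |z - y| <= e / 4; two such errors and two from the limit at [y] add up to less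
   than e. *)
have d0 : 0 < e / (4 * (K + 1)) by rewrite divr_gt0// mulr_gt0// ltr_wpDl.
have [n [a [x [Aa]]]] := nondegenerate_dense z d0.
set y := \sum_(i < n) _ => zy.
pose l := \sum_(i < n) lim ((fun j => u j (a i (x i))) @ unit_filter).
have uyl : (fun j => u j y) @ unit_filter --> l.
  rewrite [X in X @ _ --> _](_ : _ = fun j => \sum_(i < n) u j (a i (x i))).
    apply: cvg_big => [|i _]; last exact: ua.
    exact: add_continuous.
  by apply/funext => j; rewrite op_sum.
have e4 : 0 < e / 4 by rewrite divr_gt0.
move/cvg_rnormP/(_ _ e4) : uyl => uyl.
have Kd : K * rnorm (z - y) <= e / 4.
  rewrite (le_trans (ler_wpM2l K0 (ltW zy)))// invfM mulrCA ler_pM2l// mulrCA.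
  by rewrite ger_pMr// ler_pdivrMr ?mul1r ?lerDl ?ltr_wpDl.
exists [set j | opnorm (u j) <= K /\ rnorm (l - u j y) < e / 4].
  by apply: filterI.
have uzy j : opnorm (u j) <= K -> rnorm (u j z - u j y) <= e / 4.
  by move=> ujK; rewrite -opB (le_trans (le_opnorm _ _))// (le_trans _ Kd)// ler_wpM2r ?rnorm_ge0.
move=> i j [/uzy iK il] [/uzy jK jl].
have h1 := rnormB_le (u i z) (u i y) (u j z).
have h2 := rnormB_le (u i y) l (u j z).
have h3 := rnormB_le l (u j y) (u j z).
by rewrite (rnormC (u i y) l) in h2; rewrite (rnormC (u j y) (u j z)) in h3; lra.
Qed.

(** The strong limit exists, is a contraction and fixes every a x; density of their span forces it
    to be the identity. *)
Lemma unit_cvg z : (fun u : bop H => u z) @ unit_filter --> z.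
Proof.
have K1 : \forall u \near unit_filter, opnorm u <= 1.
  by apply: filterS near_unit => u [].
have uax a x : A a -> (fun u : bop H => u (a x)) @ unit_filter --> a x.
  move=> /unit_mul_cvg; apply: (cvg_lipschitz (g := fun T : bop H => T x) (K := rnorm x)).
  by move=> S T; rewrite mulrC; exact: (le_opnorm (S - T)).
have uz : forall z, cvg ((fun u : bop H => u z) @ unit_filter).
  apply: (nondegenerate_cauchy (u := id) K1) => a x Aa.
  by apply/cvg_ex; exists (a x); exact: uax.
have [T [Tu T1]] := op_limit ler01 K1 uz.
suff Tz : z = T z by have := Tu z; rewrite -Tz.
apply/eqP; rewrite -subr_eq0; apply/eqP/rnorm_eq0/eqP; rewrite eq_le rnorm_ge0 andbT.
apply/ler_addgt0Pr => e e0; rewrite add0r.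
have e2 : 0 < e / 2 by rewrite divr_gt0.
have [n [a [x [Aa]]]] := nondegenerate_dense z e2.
set y := \sum_(i < n) _ => zy.
have Ty : T y = y.
  rewrite /y op_sum; apply: eq_bigr => i _.
  by apply: (@cvg_rnorm_unique _ _ _ unit_filter _ _ _ _ (Tu _)); exact: uax.
have h := rnormB_le z y (T z); rewrite -{2}Ty -opB in h.
have := le_opnorm T (y - z); rewrite (rnormC y) => h2.
have h3 : opnorm T * rnorm (z - y) <= 1 * rnorm (z - y) by rewrite ler_wpM2r ?rnorm_ge0.
lra.
Qed.

Lemma mul_eq0_nondegenerate T : (forall a, A a -> T * a = 0) -> T = 0.
Proof.
move=> Ta0; apply: bopP => z.
apply: (@cvg_rnorm_unique _ _ _ unit_filter _ (fun u : bop H => T (u z))).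
  apply: (cvg_lipschitz (g := T) (K := opnorm T) _ (@unit_cvg z)) => x y.
  by rewrite -opB le_opnorm.
apply/cvg_rnormP => e e0; apply: filterS near_unit => u [/Ta0 Tu _ _].
by rewrite -bop_mulE Tu subrr rnorm0.
Qed.

Lemma mul_nondegenerate_eq0 T : (forall a, A a -> a * T = 0) -> T = 0.
Proof.
move=> aT0; rewrite -[T]adjK (_ : adj T = 0) ?adj0//.
apply: mul_eq0_nondegenerate => a Aa; rewrite -[a]adjK -adjM aT0 ?adj0//.
exact: Cstar_adj.
Qed.

(* [t z] is the limit of [S u z] as [u] runs through the approximate unit *)
Lemma right_module_map_mul (S : bop H -> bop H) (K : R) :
  (forall a b, A a -> A b -> S (a - b) = S a - S b) ->
  (forall a b, A a -> A b -> S (a * b) = S a * b) ->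
  (forall a, A a -> opnorm (S a) <= K * opnorm a) ->
  exists t, forall a, A a -> S a = t * a.
Proof.
move=> SB SM SK.
have K0 : 0 <= `|K| by [].
have SK' : \forall u \near unit_filter, opnorm (S u) <= `|K|.
  apply: filterS near_unit => u [Au _ u1]; rewrite (le_trans (SK _ Au))//.
  rewrite (le_trans (ler_wpM2r (opnorm_ge0 u) (ler_norm K)))//.
  by rewrite ler_piMr.
have Sax a x : A a -> (fun u => S u (a x)) @ unit_filter --> S a x.
  move=> Aa; apply/cvg_rnormP => e e0.
  have d0 : 0 < e / ((`|K| + 1) * (rnorm x + 1)).
    by rewrite divr_gt0// mulr_gt0// ltr_wpDl ?rnorm_ge0.
  move/cvg_rnormP: (unit_mul_cvg Aa) => /(_ _ d0).
  move=> h; apply: filterS2 near_unit h => u [Au _ _] ua.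
  rewrite -bop_mulE -SM// -opp_opE -bop_addE -SB//; last exact: CstarM.
  rewrite (le_lt_trans (le_opnorm _ _))//.
  have Aua : A (a - u * a) by apply: CstarB => //; exact: CstarM.
  have k1 : `|K| + 1 > 0 by rewrite ltr_wpDl.
  have x1 : rnorm x + 1 > 0 by rewrite ltr_wpDl ?rnorm_ge0.
  rewrite (@le_lt_trans _ _ ((`|K| + 1) * opnorm (a - u * a) * (rnorm x + 1)))//.
    rewrite ler_pM ?opnorm_ge0 ?rnorm_ge0 ?lerDl// (le_trans (SK _ Aua))//.
    by rewrite ler_wpM2r ?opnorm_ge0// (le_trans (ler_norm K))// lerDl.
  by rewrite mulrAC mulrC -ltr_pdivlMr// mulr_gt0.
have uz := nondegenerate_cauchy SK' _; have [|t [tS _]] := op_limit K0 SK' (uz _).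
  by move=> a x Aa; apply/cvg_ex; exists (S a x); exact: Sax.
exists t => a Aa; apply: bopP => x.
exact: (@cvg_rnorm_unique _ _ _ unit_filter _ _ _ _ (Sax a x Aa) (tS (a x))).
Qed.

(** The test row t_i u has entries in [A] because the t_i are left multipliers, and its form is at
    most that of t because u is a contraction. The limit in u yields |s| <= K |s|^(1/2); since the
    sum is finite, one root can be cancelled. *)
Lemma dual_bound_sqsum (I : eqType) (r : seq I) (t : I -> bop H) (K : R) : 0 <= K ->
  (forall i, LM A (t i)) ->
  (forall a : I -> bop H, (forall i, A (a i)) ->
    opnorm (\sum_(i <- r) a i * adj (t i)) <=
      K * Num.sqrt (opnorm (\sum_(i <- r) a i * adj (a i)))) ->
  opnorm (\sum_(i <- r) t i * adj (t i)) <= K ^+ 2.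
Proof.
move=> K0 tA tK; set s := \sum_(i <- r) _.
set q := Num.sqrt (opnorm s).
have q0 : 0 <= q by exact: sqrtr_ge0.
have sq : opnorm s = q ^+ 2 by rewrite sqr_sqrtr// opnorm_ge0.
have Kq : opnorm s <= K * q.
  apply: opnorm_leP => [|z]; first by rewrite mulr_ge0.
  have cvg_sz : (fun u : bop H => \sum_(i <- r) t i (u (adj (t i) z))) @ unit_filter
      --> s z.
    rewrite /s sum_opE; apply: cvg_big => [|i _]; first exact: add_continuous.
    apply: (cvg_lipschitz (g := t i) (K := opnorm (t i)) _ (@unit_cvg _)) => x y.
    by rewrite -opB le_opnorm.
  apply: (cvg_rnorm_le cvg_sz); apply: filterS near_unit => u [Au uu u1].
  have := tK (fun i => t i * u) (fun i => tA i u Au).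
  have -> : \sum_(i <- r) t i (u (adj (t i) z)) = (\sum_(i <- r) t i * u * adj (t i)) z.
    by rewrite sum_opE.
  move=> tuK; rewrite (le_trans (le_opnorm _ _))// ler_wpM2r ?rnorm_ge0// (le_trans tuK)//.
  rewrite ler_wpM2l// ler_wsqrtr//; apply: opnorm_sqsum; first exact: opnorm_ge0.
  move=> w; rewrite (le_trans _ (sqsum_opnorm r t w))//; apply: ler_sum => i _.
  rewrite adjM uu ler_pXn2r ?nnegrE ?rnorm_ge0// bop_mulE (le_trans (le_opnorm _ _))//.
  by rewrite ler_piMl ?rnorm_ge0.
have [q00|qn0] := eqVneq q 0; first by rewrite sq q00 expr0n/= sqr_ge0.
rewrite sq ler_pXn2r ?nnegrE//.
have q1 : 0 < q by rewrite lt_def qn0.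
by move: Kq; rewrite sq expr2 ler_pM2r.
Qed.

End UnitFilter.

(** * Bounded rows, rows with uniform tails, and their pairings *)

Section Sequences.
Context {R : realType} {H : hilbertType R}.
Implicit Types (c d t x y : nat -> bop H) (z : H).
Local Notation iota := index_iota.

(** The sign of [K] is recorded separately because the inequality says nothing about it when [H] is
    the zero space. *)
Definition sqbounded c (K : R) :=
  0 <= K /\ forall N z, sqsum (iota 0 N) c z <= K * rnorm z ^+ 2.

(** The tails are small uniformly in z: the partial sums of \sum_n c_n c_n^* are Cauchy in norm. *)
Definition sqtails c := forall e : R, 0 < e ->
  exists N, forall m n z, (N <= m)%N -> (m <= n)%N ->
    sqsum (iota m n) c z <= e * rnorm z ^+ 2.

Lemma series_ipE c d n :
  series (ip_terms c d) n = \sum_(i <- iota 0 n) c i * adj (d i).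
Proof. by []. Qed.

Lemma series_subE (V : zmodType) (u : nat -> V) m n : (m <= n)%N ->
  \sum_(i <- iota 0 n) u i - \sum_(i <- iota 0 m) u i = \sum_(i <- iota m n) u i.
Proof. exact: sub_series_geq. Qed.

Lemma sqsum_iota_le c m n p z : (m <= n)%N -> (n <= p)%N ->
  sqsum (iota m n) c z <= sqsum (iota m p) c z.
Proof.
by move=> mn np; rewrite [leRHS]/sqsum (big_cat_nat (n := n))//= lerDl sqsum_ge0.
Qed.

Lemma sqsum_tail_le c m n z : (m <= n)%N ->
  sqsum (iota m n) c z <= sqsum (iota 0 n) c z.
Proof.
by move=> mn; rewrite [leRHS]/sqsum (big_cat_nat (n := m))//= lerDr sqsum_ge0.
Qed.

(** From |v + w|^2 <= 2 |v|^2 + 2 |w|^2. The factor 2 is harmless: only boundedness and small tails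
    are deduced from it, never a norm. *)
Lemma sqsumZD (I : Type) (r : seq I) (k : R[i]) (a b : I -> bop H) z :
  sqsum r (fun i => k *: a i + b i) z <=
  2 * complex.Re `|k| ^+ 2 * sqsum r a z + 2 * sqsum r b z.
Proof.
rewrite /sqsum !mulr_sumr -big_split/=; apply: ler_sum => i _.
rewrite adjD adjZ bop_addE bop_scaleE.
set v := _ *: _; set w := adj (b i) z.
have -> : 2 * complex.Re `|k| ^+ 2 * rnorm (adj (a i) z) ^+ 2 = 2 * rnorm v ^+ 2.
  by rewrite /v rnormZ norm_conjC exprMn -mulrA.
by have := sqr_ge0 (rnorm (v - w)); rewrite rnorm_sqrB rnorm_sqrD; lra.
Qed.

Lemma sqsum_lact (I : Type) (r : seq I) (b : bop H) (a : I -> bop H) z :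
  sqsum r (fun i => b * a i) z = sqsum r a (adj b z).
Proof. by apply: eq_bigr => i _; rewrite adjM. Qed.

Lemma rnorm_adj_le (b : bop H) z : rnorm (adj b z) ^+ 2 <= opnorm b ^+ 2 * rnorm z ^+ 2.
Proof.
by rewrite -exprMn ler_pXn2r ?nnegrE ?mulr_ge0 ?opnorm_ge0 ?rnorm_ge0// -(opnorm_adj b) le_opnorm.
Qed.

Lemma sqboundedZD (k : R[i]) c d K L : sqbounded c K -> sqbounded d L ->
  sqbounded (k *: c + d) (2 * complex.Re `|k| ^+ 2 * K + 2 * L).
Proof.
move=> [K0 cK] [L0 dL].
have q2 : 0 <= 2 * complex.Re `|k| ^+ 2 by rewrite mulr_ge0 ?sqr_ge0.
split=> [|N z]; first by rewrite addr_ge0// mulr_ge0.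
rewrite (le_trans (sqsumZD _ _ _ _ _))// [leRHS]mulrDl -[X in _ <= X + _]mulrA.
by rewrite -[X in _ <= _ + X]mulrA lerD// ler_wpM2l.
Qed.

Lemma sqbounded_lact (b : bop H) c K : sqbounded c K ->
  sqbounded (lact b c) (K * opnorm b ^+ 2).
Proof.
move=> [K0 cK]; split=> [|N z]; first by rewrite mulr_ge0 ?sqr_ge0.
rewrite sqsum_lact (le_trans (cK _ _))// -mulrA ler_wpM2l//.
exact: rnorm_adj_le.
Qed.

Lemma sqtailsZD (k : R[i]) c d : sqtails c -> sqtails d -> sqtails (k *: c + d).
Proof.
move=> cT dT e e0; set q := complex.Re `|k| ^+ 2.
have q0 : 0 <= q by exact: sqr_ge0.
have e1 : 0 < e / (4 * (q + 1)) by rewrite divr_gt0// mulr_gt0// ltr_wpDl.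
have e2 : 0 < e / 4 by rewrite divr_gt0.
have [N1 N1P] := cT _ e1; have [N2 N2P] := dT _ e2.
exists (maxn N1 N2) => m n z; rewrite geq_max => /andP[m1 m2] mn.
rewrite (le_trans (sqsumZD _ _ _ _ _))// -/q; clearbody q.
have h1 := N1P m n z m1 mn; have h2 := N2P m n z m2 mn.
have : 2 * q * sqsum (iota m n) c z <= e / 2 * rnorm z ^+ 2.
  have q2 : 0 <= 2 * q by rewrite mulr_ge0.
  rewrite (le_trans (ler_wpM2l q2 h1))// mulrA ler_wpM2r ?sqr_ge0//.
  rewrite invfM !mulrA ler_pdivrMr ?ltr_wpDl//.
  have : 0 <= e * q by rewrite mulr_ge0// ltW.
  by nra.
by lra.
Qed.

Lemma sqtails_lact (b : bop H) c : sqtails c -> sqtails (lact b c).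
Proof.
move=> cT e e0; set q := opnorm b ^+ 2.
have q0 : 0 <= q by exact: sqr_ge0.
have e1 : 0 < e / (q + 1) by rewrite divr_gt0// ltr_wpDl.
have [N NP] := cT _ e1; exists N => m n z Nm mn.
rewrite sqsum_lact (le_trans (NP _ _ _ Nm mn))//.
rewrite (le_trans (ler_wpM2l (ltW e1) (rnorm_adj_le b z)))// mulrA ler_wpM2r ?sqr_ge0//.
by rewrite mulrAC ler_pdivrMr ?ltr_wpDl// ler_pM2l// lerDl.
Qed.

Lemma sqbounded_opnorm c K : sqbounded c K ->
  forall N, opnorm (series (ip_terms c c) N) <= K.
Proof. by move=> [K0 cK] N; exact: opnorm_sqsum. Qed.

Lemma opnorm_sqbounded c K : (forall N, opnorm (series (ip_terms c c) N) <= K) ->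
  sqbounded c K.
Proof.
move=> cK; split=> [|N z]; first exact: le_trans (opnorm_ge0 _) (cK 0%N).
by rewrite (le_trans (sqsum_opnorm _ _ _))// ler_wpM2r ?sqr_ge0//; exact: cK.
Qed.

(** At a fixed z the partial sums are a bounded nondecreasing real sequence. [N] depends on z, in
    contrast with [sqtails]. *)
Lemma sqsum_small c K z (e : R) : sqbounded c K -> 0 < e ->
  exists N, forall m n, (N <= m)%N -> (m <= n)%N -> sqsum (iota m n) c z < e.
Proof.
move=> [K0 cK] e0; pose s n := sqsum (iota 0 n) c z.
have : cvgn s.
  apply: nondecreasing_is_cvgn; last by exists (K * rnorm z ^+ 2) => _ [n _ <-]; exact: cK.
  by move=> m n mn; exact: sqsum_iota_le.
move=> /cvg_ex[l /cvgrPdist_lt/(_ (e / 2))]; rewrite divr_gt0// => /(_ isT)[N _ NP].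
exists N => m n Nm mn; rewrite -[ltLHS]/(\sum_(i <- _) _) -series_subE//; change (s n - s m < e).
have := NP m Nm; have := NP n (leq_trans Nm mn).
by rewrite /= !ltr_norml => /andP[h1 h2] /andP[h3 h4]; lra.
Qed.

(** On a tail, [row_bound] keeps [c] under the constant K while the form of [d] at the given vector
    tends to 0. *)
Lemma cross_strong_cvg c d K L : sqbounded c K -> sqbounded d L ->
  exists T, strong_cvg (series (ip_terms c d)) T /\ opnorm T <= Num.sqrt K * Num.sqrt L.
Proof.
move=> cK dL; have [K0 cK'] := cK; have [L0 dL'] := dL.
apply: (@op_limit _ _ _ \oo); first by rewrite mulr_ge0 ?sqrtr_ge0.
  by near=> N; exact: opnorm_row_col.
move=> z; apply: cauchy_seq_cvg => e e0.
have e1 : 0 < e ^+ 2 / (K + 1) by rewrite divr_gt0 ?exprn_gt0// ltr_wpDl.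
have [N NP] := sqsum_small z dL e1.
exists N => m n Nm mn; rewrite !series_ipE -opp_opE -bop_addE series_subE// sum_opE.
rewrite -(ltr_pXn2r (n := 2)) ?nnegrE ?rnorm_ge0 ?(ltW e0)//.
have tailK w : sqsum (iota m n) c w <= K * rnorm w ^+ 2.
  by rewrite (le_trans (sqsum_tail_le _ _ mn)).
rewrite (le_lt_trans (row_bound (fun i => adj (d i) z) K0 tailK))//.
have := NP m n Nm mn; rewrite -/(sqsum _ _ _) ltr_pdivlMr ?ltr_wpDl// mulrC.
by apply: le_lt_trans; rewrite ler_wpM2r ?sqsum_ge0// lerDl.
Unshelve. all: by end_near. Qed.

(** Uniform tails of one factor suffice for norm convergence, the other being merely bounded. This
    is what makes \sum_n a_n t_n^* converge in norm. *)
Lemma cross_cvg c d L : sqtails c -> sqbounded d L -> cvgn (series (ip_terms c d)).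
Proof.
move=> cT [L0 dL]; apply: bop_cauchy_cvg => e e0.
have e1 : 0 < e ^+ 2 / (L + 1) by rewrite divr_gt0 ?exprn_gt0// ltr_wpDl.
have [N NP] := cT _ e1; exists N => m n Nm mn.
rewrite !series_ipE series_subE//.
have dL' w : sqsum (iota m n) d w <= L * rnorm w ^+ 2.
  by rewrite (le_trans (sqsum_tail_le _ _ mn)).
rewrite (le_trans (opnorm_row_col (ltW e1) L0 (fun z => NP m n z Nm mn) dL'))//.
rewrite -sqrtrM ?(ltW e1)// -[leRHS]ger0_norm ?(ltW e0)// -sqrtr_sqr ler_wsqrtr//.
by rewrite mulrAC ler_pdivrMr ?ltr_wpDl// ler_pM2l ?exprn_gt0// lerDl.
Qed.

Lemma cvg_strong_cvg (u : nat -> bop H) T : u @ \oo --> T -> strong_cvg u T.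
Proof.
move=> uT z; apply: (cvg_lipschitz (g := fun S : bop H => S z) (K := rnorm z) _ uT).
by move=> S S'; rewrite mulrC; exact: (le_opnorm (S - S')).
Qed.

Lemma strong_cvg_unique (u : nat -> bop H) S T : strong_cvg u S -> strong_cvg u T -> S = T.
Proof. by move=> uS uT; apply: bopP => z; exact: cvg_rnorm_unique (uS z) (uT z). Qed.

(** The forms increase with the number of terms, so each is below the limit. Convergence is asked at
    a single vector, because strict convergence provides it only at vectors u z. *)
Lemma sqsum_le_limit c z w : (fun n => series (ip_terms c c) n z) @ \oo --> w ->
  forall N, sqsum (iota 0 N) c z <= rnorm w * rnorm z.
Proof.
move=> cw N; apply/ler_addgt0Pr => e e0.
have e1 : 0 < e / (rnorm z + 1) by rewrite divr_gt0// ltr_wpDl ?rnorm_ge0.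
have /cvg_seq_rnormP/(_ _ e1)[M MP] := cw.
set n := maxn M N; have := MP n (leq_maxl _ _); rewrite rnormC => /ltW TN.
rewrite (le_trans (sqsum_iota_le c z (leq0n N) (leq_maxr M N)))// -/n.
rewrite sqsum_rinner -[\sum_(i <- _) _]/(series (ip_terms c c) n).
rewrite -(subrK w (series (ip_terms c c) n z)) rinnerDl addrC lerD// ?rinner_le//.
rewrite (le_trans (rinner_le _ _))// (le_trans (ler_wpM2r (rnorm_ge0 z) TN))//.
by rewrite mulrAC ler_pdivrMr ?ltr_wpDl ?rnorm_ge0// ler_pM2l// lerDl.
Qed.

Lemma sqbounded_strong_limit c T : strong_cvg (series (ip_terms c c)) T ->
  sqbounded c (opnorm T).
Proof.
move=> cT; split=> [|N z]; first exact: opnorm_ge0.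
rewrite (le_trans (sqsum_le_limit (@cT z) N))// expr2 mulrA.
by rewrite ler_wpM2r ?rnorm_ge0 ?le_opnorm.
Qed.

Lemma opnorm_strong_limit c T K : strong_cvg (series (ip_terms c c)) T ->
  sqbounded c K -> opnorm T <= K.
Proof.
move=> cT cK; have [T' [cT' T'K]] := cross_strong_cvg cK cK.
rewrite (strong_cvg_unique cT cT') (le_trans T'K)// -expr2 sqr_sqrtr//.
by case: cK.
Qed.

Lemma l2strong_norm_lim c T : strong_cvg (series (ip_terms c c)) T ->
  l2strong_norm c = Num.sqrt (opnorm T).
Proof.
move=> cT; rewrite /l2strong_norm; congr (Num.sqrt (opnorm _)).
by apply: xget_unique => // S cS; exact: strong_cvg_unique cS cT.
Qed.

Lemma l2strong_norm_ge0 c : 0 <= l2strong_norm c.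
Proof. exact: sqrtr_ge0. Qed.

(** Any bound, however crude, makes the strong limit exist, and the limit is then itself the sharp
    bound. *)
Lemma sqbounded_norm c K : sqbounded c K -> sqbounded c (l2strong_norm c ^+ 2).
Proof.
move=> cK; have [T [cT _]] := cross_strong_cvg cK cK.
by rewrite (l2strong_norm_lim cT) sqr_sqrtr ?opnorm_ge0//; exact: sqbounded_strong_limit.
Qed.

Lemma l2strong_norm_le c K : 0 <= K -> sqbounded c (K ^+ 2) -> l2strong_norm c <= K.
Proof.
move=> K0 cK; have [T [cT _]] := cross_strong_cvg cK cK.
rewrite (l2strong_norm_lim cT) -[leRHS]ger0_norm// -sqrtr_sqr ler_wsqrtr//.
exact: opnorm_strong_limit cT cK.
Qed.

Lemma opnorm_cross_lim c d K L S : sqbounded c K -> sqbounded d L ->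
  series (ip_terms c d) @ \oo --> S ->
  opnorm S <= l2strong_norm c * l2strong_norm d.
Proof.
move=> /sqbounded_norm cK /sqbounded_norm dL /cvg_strong_cvg cS.
have [T [cT TK]] := cross_strong_cvg cK dL.
by rewrite (strong_cvg_unique cS cT) (le_trans TK)// !sqrtr_sqr !ger0_norm ?l2strong_norm_ge0.
Qed.

Lemma cvg_sqtails c : cvgn (series (ip_terms c c)) -> sqtails c.
Proof.
move=> /cvg_ex[T /cvg_seq_rnormP cT] e e0.
have e2 : 0 < e / 2 by rewrite divr_gt0.
have [N NP] := cT _ e2; exists N => m n z Nm mn.
rewrite (le_trans (sqsum_opnorm _ _ _))// ler_wpM2r ?sqr_ge0//.
rewrite -series_subE// -!series_ipE.
have h1 := NP m Nm; have h2 := NP n (leq_trans Nm mn).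
have := rnormB_le (series (ip_terms c c) n) T (series (ip_terms c c) m).
rewrite (rnormC _ T) -[X in X <= _]/(opnorm _); lra.
Qed.

Lemma l2_norm_strong c : cvgn (series (ip_terms c c)) -> l2_norm c = l2strong_norm c.
Proof. by move=> cT; rewrite (l2strong_norm_lim (cvg_strong_cvg cT)). Qed.

Lemma sqtails_bounded c : sqtails c -> exists K, sqbounded c K.
Proof.
move=> cT; have [N NP] := cT 1 ltr01.
exists (opnorm (series (ip_terms c c) N) + 1); split=> [|n z].
  by rewrite addr_ge0// opnorm_ge0.
have cN := sqsum_opnorm (iota 0 N) c z; rewrite mulrDl.
case: (leqP n N) => [nN|/ltnW Nn].
  rewrite (le_trans (sqsum_iota_le c z (leq0n n) nN))// (le_trans cN)// lerDl.
  by rewrite mul1r sqr_ge0.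
rewrite {1}/sqsum (big_cat_nat (n := N))//= lerD//.
by have := NP N n z (leqnn _) Nn.
Qed.

Lemma series_ipZDl (k : R[i]) c d t n :
  series (ip_terms (k *: c + d) t) n =
  k *: series (ip_terms c t) n + series (ip_terms d t) n.
Proof.
rewrite !series_ipE scaler_sumr -big_split/=; apply: eq_bigr => i _.
by rewrite scale_opAl -mulrDl.
Qed.

Lemma series_ipZDr (k : R[i]) c d t n :
  series (ip_terms t (k *: c + d)) n =
  k^* *: series (ip_terms t c) n + series (ip_terms t d) n.
Proof.
rewrite !series_ipE scaler_sumr -big_split/=; apply: eq_bigr => i _.
by rewrite adjD adjZ mulrDr -scale_opAr.
Qed.

Lemma series_ip_lactl b c d n :
  series (ip_terms (lact b c) d) n = b * series (ip_terms c d) n.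
Proof.
by rewrite !series_ipE mulr_sumr; apply: eq_bigr => i _; rewrite mulrA.
Qed.

Lemma series_ip_lactr b c d n :
  series (ip_terms c (lact b d)) n = series (ip_terms c d) n * adj b.
Proof.
by rewrite !series_ipE mulr_suml; apply: eq_bigr => i _; rewrite adjM mulrA.
Qed.

Lemma adj_series_ip c d n :
  adj (series (ip_terms c d) n) = series (ip_terms d c) n.
Proof.
by rewrite !series_ipE adj_sum; apply: eq_bigr => i _; rewrite adjM adjK.
Qed.

Lemma series_ip_eventually0 c d N n : (forall i, (N <= i)%N -> c i = 0) ->
  (N <= n)%N -> series (ip_terms c d) n = series (ip_terms c d) N.
Proof.
move=> c0 Nn; apply/eqP; rewrite -subr_eq0 !series_ipE series_subE//; apply/eqP.
rewrite big_nat_cond big1// => i /andP[/andP[Ni _] _].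
by rewrite c0// mul0r.
Qed.

Lemma cvg_eventually0 c d N : (forall i, (N <= i)%N -> c i = 0) ->
  series (ip_terms c d) @ \oo --> series (ip_terms c d) N.
Proof.
move=> c0; apply/cvg_seq_rnormP => e e0; exists N => n Nn.
by rewrite (series_ip_eventually0 d c0 Nn) subrr rnorm0.
Qed.

Lemma cvg_mull (a T : bop H) (u : nat -> bop H) :
  u @ \oo --> T -> (fun n => a * u n) @ \oo --> a * T.
Proof.
move=> uT; apply: (@cvg_lipschitz R (bop H) (bop H) (fun S => a * S) (opnorm a) _ _ _ _ _ _ uT) => S S'.
by rewrite -mulrBr; exact: opnorm_mul.
Qed.

Lemma cvg_mulr (a T : bop H) (u : nat -> bop H) :
  u @ \oo --> T -> (fun n => u n * a) @ \oo --> T * a.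
Proof.
move=> uT; apply: (@cvg_lipschitz R (bop H) (bop H) (fun S => S * a) (opnorm a) _ _ _ _ _ _ uT) => S S'.
by rewrite -mulrBl mulrC; exact: opnorm_mul.
Qed.

Lemma cvg_adj (T : bop H) (u : nat -> bop H) :
  u @ \oo --> T -> (fun n => adj (u n)) @ \oo --> adj T.
Proof.
move=> uT; apply: (@cvg_lipschitz R (bop H) (bop H) (@adj R H) 1 _ _ _ _ _ _ uT) => S S'.
by rewrite -adjB mul1r; exact: opnorm_adj_le.
Qed.

Lemma limn_eq (u : nat -> bop H) (T : bop H) : u @ \oo --> T -> limn u = T.
Proof.
move=> uT; have uc : cvgn u by apply/cvg_ex; exists T.
exact: (@cvg_rnorm_unique R (bop H) _ _ _ _ _ _ uc uT).
Qed.

End Sequences.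

(** * Multipliers, the sequence spaces as modules, and the map phi *)

Section Multipliers.
Context {R : realType} {H : hilbertType R}.
Variable A : set (bop H).
Hypothesis A_Cstar : Cstar_algebra A.
Implicit Types (a b : bop H) (c d t x y : nat -> bop H) (z : H).

(** a t^* is the adjoint of t a^* and so lies in [A]; this keeps the partial sums of \sum_n a_n
    t_n^* in [A]. *)
Lemma LM_adjr (t a : bop H) : LM A t -> A a -> A (a * adj t).
Proof.
move=> tA Aa; rewrite -[a]adjK -adjM; apply: Cstar_adj => //.
by apply: tA; exact: Cstar_adj.
Qed.

Lemma adj_RM (t : bop H) : RM A (adj t) -> LM A t.
Proof.
move=> tA a Aa; rewrite -[t]adjK -[a]adjK -adjM; apply: Cstar_adj => //.
by apply: tA; exact: Cstar_adj.
Qed.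

Lemma LM_ZD (k : R[i]) (s t : bop H) : LM A s -> LM A t -> LM A (k *: s + t).
Proof.
by move=> sA tA a Aa; rewrite mulrDl -scale_opAl; apply: CstarZD; [|exact: sA|exact: tA].
Qed.

Lemma RM_ZD (k : R[i]) (s t : bop H) : RM A s -> RM A t -> RM A (k *: s + t).
Proof.
by move=> sA tA a Aa; rewrite mulrDr -scale_opAr; apply: CstarZD; [|exact: sA|exact: tA].
Qed.

Lemma multipliersM (s t : bop H) : multipliers A s -> multipliers A t -> multipliers A (s * t).
Proof.
move=> [sl sr] [tl tr]; split=> a Aa.
  by rewrite -mulrA; apply/sl/tl.
by rewrite mulrA; apply/tr/sr.
Qed.

Lemma multipliers_adj (t : bop H) : multipliers A t -> multipliers A (adj t).
Proof.
move=> [tl tr]; split=> a Aa; last exact: LM_adjr.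
by rewrite -[a]adjK -adjM; apply: Cstar_adj => //; apply: tr; exact: Cstar_adj.
Qed.

Lemma multipliers_sub a : A a -> multipliers A a.
Proof. by move=> Aa; split=> b Ab; exact: CstarM. Qed.

Lemma l2P x : l2 A x <-> (forall n, A (x n)) /\ sqtails x.
Proof.
split=> [[Ax xc]|[Ax xT]]; split=> //; first exact: cvg_sqtails.
by have [K xK] := sqtails_bounded xT; exact: cross_cvg xT xK.
Qed.

Lemma l2strongP c : l2strong A c <-> (forall n, LM A (c n)) /\ exists K, sqbounded c K.
Proof.
split=> [[cA [K cK]]|[cA [K cK]]]; split=> //; exists K.
  exact: opnorm_sqbounded.
exact: sqbounded_opnorm.
Qed.

Lemma l2_l2strong x : l2 A x -> l2strong A x.
Proof.
case/l2P => Ax xT; apply/l2strongP; split; last exact: sqtails_bounded.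
by move=> n; have [] := multipliers_sub (Ax n).
Qed.

Lemma l2strong_bounded c : l2strong A c -> exists K, sqbounded c K.
Proof. by case/l2strongP. Qed.

Lemma l2_bounded x : l2 A x -> exists K, sqbounded x K.
Proof. by move/l2_l2strong/l2strong_bounded. Qed.

Lemma l2_normE x : l2 A x -> l2_norm x = l2strong_norm x.
Proof. by case=> _; exact: l2_norm_strong. Qed.

Lemma l2_ZD (k : R[i]) x y : l2 A x -> l2 A y -> l2 A (k *: x + y).
Proof.
move=> /l2P[Ax xT] /l2P[Ay yT]; apply/l2P; split; last exact: sqtailsZD.
by move=> n; exact: CstarZD.
Qed.

Lemma l2_lact b x : (forall n, A (b * x n)) -> sqtails x -> l2 A (lact b x).
Proof. by move=> Abx xT; apply/l2P; split=> //; exact: sqtails_lact. Qed.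

Lemma l2_lactA b x : A b -> l2 A x -> l2 A (lact b x).
Proof. by move=> Ab /l2P[Ax xT]; apply: l2_lact => // n; exact: CstarM. Qed.

Lemma l2_eventually0 x N : (forall n, A (x n)) ->
  (forall i, (N <= i)%N -> x i = 0) -> l2 A x.
Proof.
move=> Ax x0; split=> //; apply/cvg_ex; exists (series (ip_terms x x) N).
exact: cvg_eventually0.
Qed.

Lemma l2strong_ZD (k : R[i]) c d : l2strong A c -> l2strong A d -> l2strong A (k *: c + d).
Proof.
move=> /l2strongP[cA [K cK]] /l2strongP[dA [L dL]]; apply/l2strongP; split.
  by move=> n; exact: LM_ZD.
by eexists; exact: sqboundedZD cK dL.
Qed.

Lemma l2strong_lact b c : LM A b -> l2strong A c -> l2strong A (lact b c).
Proof.
move=> bA /l2strongP[cA [K cK]]; apply/l2strongP; split.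
  by move=> n a Aa; rewrite -mulrA; apply/bA/cA.
by eexists; exact: sqbounded_lact cK.
Qed.

Lemma ip_in_Cstar x t n : (forall n, A (x n)) -> (forall n, LM A (t n)) ->
  A (series (ip_terms x t) n).
Proof. by move=> Ax tA; apply: Cstar_sum => // i _; exact: LM_adjr. Qed.

Lemma Cstar_lim (u : nat -> bop H) T : (forall n, A (u n)) -> u @ \oo --> T -> A T.
Proof.
move=> Au uT; apply: (closed_cvg A (Cstar_closed A_Cstar) _ T uT).
by near=> n; exact: Au.
Unshelve. all: by end_near. Qed.

Lemma ip_cvg x t : l2strong A t -> l2 A x -> cvgn (series (ip_terms x t)).
Proof.
move=> /l2strong_bounded[K tK] /l2P[_ xT]; exact: cross_cvg xT tK.
Qed.

Lemma ip_lim_in_Cstar x t : l2strong A t -> l2 A x -> A (limn (series (ip_terms x t))).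
Proof.
move=> tl xl; apply: (Cstar_lim _ (ip_cvg tl xl)) => n.
by apply: ip_in_Cstar; [case/l2P: xl|case/l2strongP: tl].
Qed.

Lemma phi_lim t (x : set_type (l2 A)) : l2strong A t ->
  series (ip_terms (val x) t) @ \oo --> phi A t x.
Proof. by move=> tl; apply: ip_cvg => //; exact: set_mem (valP x). Qed.

Lemma phi_eq t (x : set_type (l2 A)) T :
  series (ip_terms (val x) t) @ \oo --> T -> phi A t x = T.
Proof. exact: limn_eq. Qed.

Lemma phi_l2_dual t : l2strong A t -> l2_dual A (phi A t).
Proof.
move=> tl; split.
- by move=> x; apply: ip_lim_in_Cstar => //; exact: set_mem (valP x).
- move=> k x y z zE; apply: phi_eq => //; rewrite zE.
  rewrite (_ : series _ = (k \*: series (ip_terms (val x) t)) + series (ip_terms (val y) t)).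
    by apply: cvgD; [apply: cvgZl_tmp|]; exact: phi_lim.
  by apply/funext => n; rewrite series_ipZDl.
- move=> a x z Aa zE; apply: phi_eq => //; rewrite zE.
  rewrite (_ : series _ = fun n => a * series (ip_terms (val x) t) n).
    by apply: cvg_mull; exact: phi_lim.
  by apply/funext => n; rewrite series_ip_lactl.
- exists (l2strong_norm t) => x; rewrite mulrC.
  have xl : l2 A (val x) := set_mem (valP x).
  have [K xK] := l2_bounded xl; have [L tL] := l2strong_bounded tl.
  by rewrite (l2_normE xl); exact: opnorm_cross_lim xK tL (phi_lim tl).
Qed.

Lemma phi_antilinear (k : R[i]) t s : l2strong A t -> l2strong A s ->
  phi A (k *: t + s) = k^* *: phi A t + phi A s.
Proof.
move=> tl sl; apply/funext => x; apply: phi_eq.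
rewrite (_ : series _ = (k^* \*: series (ip_terms (val x) t)) + series (ip_terms (val x) s)).
  by apply: cvgD; [apply: cvgZl_tmp|]; exact: phi_lim.
by apply/funext => n; rewrite series_ipZDr.
Qed.

Lemma phi_lact b t : l2strong A t -> phi A (lact b t) = ract (phi A t) (adj b).
Proof.
move=> tl; apply/funext => x; apply: phi_eq.
rewrite (_ : series _ = fun n => series (ip_terms (val x) t) n * adj b).
  by apply: cvg_mulr; exact: phi_lim.
by apply/funext => n; rewrite series_ip_lactr.
Qed.

End Multipliers.

(** * The dual of l^2(A) *)

Section Dual.
Context {R : realType} {H : hilbertType R}.
Variable A : set (bop H).
Hypothesis A_Cstar : Cstar_algebra A.
Hypothesis A_nondegenerate : acts_nondegenerately A.
Implicit Types (a b : bop H) (c d t x y : nat -> bop H) (z : H).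
Implicit Types (L : set_type (l2 A) -> bop H).

Definition mkl2 x (xl : l2 A x) : set_type (l2 A) := exist _ x (mem_set xl).

(* [L] lives on the subtype [set_type (l2 A)]; extending it by 0 lets us add and
   scale sequences in the ambient space. *)
Definition ext L x : bop H :=
  match pselect (l2 A x) with left xl => L (mkl2 xl) | right _ => 0 end.

Lemma extE L (x : set_type (l2 A)) : ext L (val x) = L x.
Proof.
rewrite /ext; case: pselect => [xl|]; last by case; exact: set_mem (valP x).
by congr L; exact: val_inj.
Qed.

Lemma ext_mk L x (xl : l2 A x) : ext L x = L (mkl2 xl).
Proof. by rewrite -extE. Qed.

Lemma extZD L (k : R[i]) x y : l2_dual A L -> l2 A x -> l2 A y ->
  ext L (k *: x + y) = k *: ext L x + ext L y.
Proof.
move=> [_ LZD _ _] xl yl; rewrite (ext_mk L xl) (ext_mk L yl).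
by rewrite (ext_mk L (l2_ZD A_Cstar k xl yl)); exact: LZD.
Qed.

Lemma ext_lact L a x : l2_dual A L -> A a -> l2 A x -> ext L (lact a x) = a * ext L x.
Proof.
move=> [_ _ La _] Aa xl; rewrite (ext_mk L xl) (ext_mk L (l2_lactA A_Cstar Aa xl)).
exact: La.
Qed.

Lemma ext_in L x : l2_dual A L -> l2 A x -> A (ext L x).
Proof. by move=> [LA _ _ _] xl; rewrite (ext_mk L xl). Qed.

Lemma l2_zero : l2 A 0.
Proof. by apply: (@l2_eventually0 _ _ _ 0 0%N) => // n; exact: Cstar0. Qed.

Lemma ext0 L : l2_dual A L -> ext L 0 = 0.
Proof.
move=> Ld; have := extZD (-1) Ld l2_zero l2_zero.
by rewrite scaler0 addr0 scaleN1r addNr.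
Qed.

Lemma extZ L (k : R[i]) x : l2_dual A L -> l2 A x -> ext L (k *: x) = k *: ext L x.
Proof.
by move=> Ld xl; rewrite -[k *: x]addr0 (extZD k Ld xl l2_zero) ext0// addr0.
Qed.

Lemma l2strong_normZ_le (k : R) x K : sqbounded x K ->
  l2strong_norm ((k%:C)%C *: x) <= `|k| * l2strong_norm x.
Proof.
move=> /sqbounded_norm[K0 xK].
apply: l2strong_norm_le; first by rewrite mulr_ge0 ?l2strong_norm_ge0.
rewrite exprMn; split=> [|N z]; first by rewrite mulr_ge0 ?sqr_ge0.
rewrite -mulrA (le_trans _ (ler_wpM2l (sqr_ge0 `|k|) (xK N z)))//.
rewrite /sqsum mulr_sumr; apply: ler_sum => i _.
rewrite adjZ bop_scaleE rnormZ norm_conjC exprMn normc_def/= expr0n/= addr0 sqrtr_sqr.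
by [].
Qed.

Let dual_set L := [set opnorm (L x) | x in [set x | l2_norm (val x) <= 1]].

Lemma dual_has_sup L : l2_dual A L -> has_sup (dual_set L).
Proof.
move=> Ld; split.
  exists (opnorm (L (mkl2 l2_zero))), (mkl2 l2_zero) => //=.
  rewrite (l2_normE l2_zero); apply: l2strong_norm_le => //.
  rewrite expr1n; split=> // N z; rewrite /sqsum big1 ?mul1r ?sqr_ge0// => i _.
  by rewrite adj0 rnorm0 expr0n.
case: Ld => _ _ _ [K LK]; exists `|K| => _ [x /= x1 <-].
rewrite (le_trans (LK x))// (le_trans (ler_wpM2r (sqrtr_ge0 _) (ler_norm K)))//.
by rewrite ler_piMr.
Qed.

Lemma dual_norm_ge0 L : l2_dual A L -> 0 <= l2_dual_norm A L.
Proof.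
move=> /dual_has_sup[[r Dr] ub]; apply: (@le_trans _ _ r).
  by case: Dr => x _ <-; exact: opnorm_ge0.
exact: ub_le_sup.
Qed.

Lemma dual_norm_le L K : l2_dual A L ->
  (forall x : set_type (l2 A), opnorm (L x) <= K * l2_norm (val x)) -> 0 <= K -> l2_dual_norm A L <= K.
Proof.
move=> /dual_has_sup[ne _] LK K0; apply: ge_sup => // _ [x /= x1 <-].
by rewrite (le_trans (LK x))// ler_piMr.
Qed.

Lemma ext_norm L x : l2_dual A L -> l2 A x ->
  opnorm (ext L x) <= l2_dual_norm A L * l2strong_norm x.
Proof.
move=> Ld xl; have [x0|x0] := eqVneq (l2strong_norm x) 0.
  (* A vector of norm 0 cannot be normalised; the unspecified bound in the definition of the dual
     already makes its image 0. *)
  case: (Ld) => _ _ _ [K /(_ (mkl2 xl))].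
  by rewrite -ext_mk /= (l2_normE xl) x0 !mulr0.
have xgt0 : 0 < l2strong_norm x by rewrite lt_def x0 l2strong_norm_ge0.
set k := (l2strong_norm x)^-1; have k0 : 0 < k by rewrite invr_gt0.
have [K xK] := l2_bounded A_Cstar xl.
have kxl : l2 A ((k%:C)%C *: x).
  by rewrite -[_ *: _]addr0; apply: l2_ZD => //; exact: l2_zero.
have kx1 : l2_norm ((k%:C)%C *: x) <= 1.
  rewrite (l2_normE kxl) (le_trans (l2strong_normZ_le k xK))//.
  by rewrite (ger0_norm (ltW k0)) mulVf.
rewrite -ler_pdivrMr// mulrC.
have -> : k * opnorm (ext L x) = opnorm (ext L ((k%:C)%C *: x)).
  by rewrite (extZ _ Ld xl) -[RHS]rnorm_opnorm rnormZr (ger0_norm (ltW k0)).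
apply: ub_le_sup; first by have [] := dual_has_sup Ld.
by exists (mkl2 kxl) => //; rewrite -ext_mk.
Qed.

Definition trunc N (a : nat -> bop H) : nat -> bop H :=
  fun n => if (n < N)%N then a n else 0.
Definition single N (b : bop H) : nat -> bop H :=
  fun n => if n == N then b else 0.

Lemma trunc0 N (a : nat -> bop H) i : (N <= i)%N -> trunc N a i = 0.
Proof. by rewrite /trunc ltnNge => ->. Qed.

Lemma single0 N b i : (N.+1 <= i)%N -> single N b i = 0.
Proof. by rewrite /single; case: eqP => // ->; rewrite ltnn. Qed.

Lemma l2_trunc N (a : nat -> bop H) : (forall n, A (a n)) -> l2 A (trunc N a).
Proof.
move=> Aa; apply: (l2_eventually0 _ (@trunc0 N a)) => n.
by rewrite /trunc; case: ifP => // _; exact: Cstar0.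
Qed.

Lemma l2_single N b : A b -> l2 A (single N b).
Proof.
move=> Ab; apply: (l2_eventually0 _ (@single0 N b)) => n.
by rewrite /single; case: ifP => // _; exact: Cstar0.
Qed.

Lemma series_trunc N (a : nat -> bop H) t :
  series (ip_terms (trunc N a) t) N = series (ip_terms a t) N.
Proof.
rewrite !series_ipE; apply: eq_big_nat => i /andP[_ iN].
by rewrite /trunc iN.
Qed.

Lemma series_trunc2 N (a : nat -> bop H) :
  series (ip_terms (trunc N a) (trunc N a)) N = series (ip_terms a a) N.
Proof.
rewrite !series_ipE; apply: eq_big_nat => i /andP[_ iN].
by rewrite /trunc iN.
Qed.

Lemma series_single N b t : series (ip_terms (single N b) t) N.+1 = b * adj (t N).
Proof.
rewrite series_ipE big_nat_recr//= big_nat_cond big1 ?add0r => [|i /andP[/andP[_ iN] _]].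
  by rewrite /single eqxx.
by rewrite /single ltn_eqF// mul0r.
Qed.

Lemma phi_trunc N (a : nat -> bop H) t (x : set_type (l2 A)) : val x = trunc N a ->
  phi A t x = series (ip_terms a t) N.
Proof.
move=> xE; rewrite -series_trunc; apply: limn_eq; rewrite xE.
by apply: cvg_eventually0; exact: trunc0.
Qed.

Lemma phi_single N b t (x : set_type (l2 A)) : val x = single N b ->
  phi A t x = b * adj (t N).
Proof.
move=> xE; rewrite -series_single; apply: limn_eq; rewrite xE.
by apply: cvg_eventually0; exact: single0.
Qed.

Lemma l2_norm_trunc N (a : nat -> bop H) : (forall n, A (a n)) ->
  l2strong_norm (trunc N a) = Num.sqrt (opnorm (series (ip_terms a a) N)).
Proof.
move=> Aa; rewrite -(l2_normE (l2_trunc N Aa)) -series_trunc2.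
congr (Num.sqrt (opnorm _)); apply: limn_eq.
by apply: cvg_eventually0; exact: trunc0.
Qed.

Lemma l2_norm_single N b : A b -> l2strong_norm (single N b) <= opnorm b.
Proof.
move=> Ab; rewrite -(l2_normE (l2_single N Ab)).
have -> : l2_norm (single N b) = Num.sqrt (opnorm (b * adj b)).
  congr (Num.sqrt (opnorm _)); apply: limn_eq.
  have := @cvg_eventually0 _ _ _ (single N b) _ (@single0 N b).
  by rewrite series_single; have -> : single N b N = b by rewrite /single eqxx.
rewrite -[leRHS]ger0_norm ?opnorm_ge0// -sqrtr_sqr ler_wsqrtr//.
by rewrite (le_trans (opnorm_mul _ _))// opnorm_adj expr2.
Qed.

(** Only values on truncations enter, so [t] need not be known to be bounded. The same estimate thus
    gives the isometry of [phi] and the boundedness of the coefficients of an abstract [L]. *)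
Lemma dual_norm_sqbounded L t : l2_dual A L -> (forall n, LM A (t n)) ->
  (forall N (a : nat -> bop H), (forall n, A (a n)) ->
    ext L (trunc N a) = series (ip_terms a t) N) ->
  sqbounded t (l2_dual_norm A L ^+ 2).
Proof.
move=> Ld tA Lt; apply: opnorm_sqbounded => N.
apply: (dual_bound_sqsum A_Cstar A_nondegenerate (dual_norm_ge0 Ld) tA) => a Aa.
rewrite -[\sum_(i <- _) a i * adj (t i)]/(series (ip_terms a t) N) -Lt//.
rewrite -[\sum_(i <- _) a i * adj (a i)]/(series (ip_terms a a) N) -l2_norm_trunc//.
by apply: ext_norm => //; exact: l2_trunc.
Qed.

Lemma ext_phi_trunc t N (a : nat -> bop H) : (forall n, A (a n)) ->
  ext (phi A t) (trunc N a) = series (ip_terms a t) N.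
Proof. by move=> Aa; rewrite (ext_mk _ (l2_trunc N Aa)); exact: phi_trunc. Qed.

Lemma phi_norm t : l2strong A t -> l2_dual_norm A (phi A t) = l2strong_norm t.
Proof.
move=> tl; have Ld := phi_l2_dual A_Cstar tl; apply/eqP; rewrite eq_le; apply/andP; split.
  apply: dual_norm_le => // [x|]; last exact: l2strong_norm_ge0.
  have xl : l2 A (val x) := set_mem (valP x).
  have [K xK] := l2_bounded A_Cstar xl; have [L tL] := l2strong_bounded tl.
  by rewrite (l2_normE xl) mulrC; exact: opnorm_cross_lim xK tL (phi_lim tl).
apply: l2strong_norm_le; first exact: dual_norm_ge0.
apply: dual_norm_sqbounded => // [|N a Aa]; first by case/l2strongP: tl.
exact: ext_phi_trunc.
Qed.

Lemma dual_eq_trunc L L' : l2_dual A L -> l2_dual A L' ->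
  (forall N (a : nat -> bop H), (forall n, A (a n)) ->
    ext L (trunc N a) = ext L' (trunc N a)) ->
  L = L'.
Proof.
move=> Ld Ld' LL'; apply/funext => x; rewrite -!extE.
have xl : l2 A (val x) := set_mem (valP x); move: (val x) xl => {}x xl.
have [Ax xT] := (l2P A x).1 xl.
apply/eqP; rewrite -subr_eq0; apply/eqP/(@rnorm_eq0 _ (bop H))/eqP.
rewrite eq_le rnorm_ge0 andbT; apply/ler_addgt0Pr => e e0; rewrite add0r.
set K := l2_dual_norm A L + l2_dual_norm A L'.
have K0 : 0 <= K by rewrite addr_ge0 ?dual_norm_ge0.
have e1 : 0 < e / (K + 1) by rewrite divr_gt0// ltr_wpDl.
have [N NP] := xT _ (exprn_gt0 2 e1).
set y := x - trunc N x.
have Ntl := l2_trunc N Ax.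
have yl : l2 A y by rewrite /y addrC -scaleN1r; exact: l2_ZD.
(* [y] vanishes below [N] and agrees with [x] from [N] on, so its form is a tail of that of [x]. *)
have y1 : l2strong_norm y <= e / (K + 1).
  apply: l2strong_norm_le; first exact: ltW.
  split=> [|n z]; first exact: sqr_ge0.
  have [nN|/ltnW Nn] := leqP n N.
    rewrite /sqsum big_nat_cond big1 => [|i /andP[/andP[_ iN] _]].
      exact: mulr_ge0 (sqr_ge0 _) (sqr_ge0 _).
    by rewrite /y !fctE /trunc (leq_trans iN nN) subrr adj0 rnorm0 expr0n.
  rewrite /sqsum (big_cat_nat (n := N))//= big_nat_cond big1 ?add0r; last first.
    move=> i /andP[/andP[_ iN] _].
    by rewrite /y !fctE /trunc iN subrr adj0 rnorm0 expr0n.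
  rewrite (le_trans _ (NP N n z (leqnn _) Nn))// /sqsum le_eqVlt; apply/orP; left; apply/eqP.
  apply: eq_big_nat => i /andP[Ni _].
  by rewrite /y !fctE /trunc ltnNge Ni subr0.
have xE : x = 1 *: y + trunc N x by rewrite scale1r /y subrK.
have -> : ext L x - ext L' x = ext L y - ext L' y.
  rewrite xE (extZD 1 Ld yl Ntl) (extZD 1 Ld' yl Ntl) !scale1r LL'//.
  by rewrite opprD addrACA subrr addr0.
have h1 := ext_norm Ld yl; have h2 := ext_norm Ld' yl.
have h3 : K * l2strong_norm y <= e.
  rewrite (le_trans (ler_wpM2l K0 y1))// mulrCA ger_pMr// ler_pdivrMr ?ltr_wpDl//.
  by rewrite mul1r lerDl.
rewrite (le_trans (rnormD _ _))// rnormN (le_trans _ h3)// /K mulrDl.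
exact: lerD.
Qed.

(** Conjugating by adjoints turns the left module map b |-> L(b e_n) into a right module map on [A],
    which is left multiplication by an operator t; taking adjoints back gives b t^* as the value at
    b e_n. *)
Lemma dual_coefficient L n : l2_dual A L ->
  exists t : bop H, forall b, A b -> ext L (single n b) = b * adj t.
Proof.
move=> Ld; pose S a := adj (ext L (single n (adj a))).
have Aadj a : A a -> A (adj a) by exact: Cstar_adj.
have [|||t tS] := @right_module_map_mul _ _ _ A_Cstar A_nondegenerate S (l2_dual_norm A L).
- move=> a b Aa Ab; rewrite /S -adjB.
  have -> : single n (adj (a - b)) = -1 *: single n (adj b) + single n (adj a).
    apply/funext => i; rewrite !fctE /single; case: eqP => _.
      by rewrite adjB scaleN1r addrC.
    by rewrite scaler0 addr0.
  rewrite extZD//; [|exact: l2_single (Aadj _ Ab)|exact: l2_single (Aadj _ Aa)].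
  by rewrite scaleN1r addrC.
- move=> a b Aa Ab; rewrite /S.
  have -> : single n (adj (a * b)) = lact (adj b) (single n (adj a)).
    apply/funext => i; rewrite /lact /single; case: eqP => _; last by rewrite mulr0.
    by rewrite adjM.
  rewrite ext_lact//; [|exact: Aadj|exact: l2_single (Aadj _ Aa)].
  by rewrite adjM adjK.
- move=> a Aa; rewrite /S opnorm_adj (le_trans (ext_norm Ld (l2_single n (Aadj _ Aa))))//.
  by rewrite ler_wpM2l ?dual_norm_ge0// -(opnorm_adj a) l2_norm_single//; exact: Aadj.
exists t => b Ab.
by have := tS _ (Aadj _ Ab); rewrite /S adjK => /(congr1 (@adj _ _)); rewrite adjK adjM adjK.
Qed.

Lemma phi_surj L : l2_dual A L -> exists2 t, l2strong A t & phi A t = L.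
Proof.
move=> Ld; have /choice[t tL] := fun n => dual_coefficient n Ld.
(* a t_n^* is a value of [L], hence in [A], for every a in [A]. *)
have tA n : LM A (t n).
  apply: adj_RM => // a Aa; rewrite -tL//; apply: ext_in => //.
  exact: l2_single.
have Ltrunc N (a : nat -> bop H) : (forall n, A (a n)) ->
    ext L (trunc N a) = series (ip_terms a t) N.
  move=> Aa; elim: N => [|N IH].
    (* [trunc 0 a] is convertible to the zero sequence. *)
    rewrite series_ipE big_nil -(ext0 Ld); congr ext.
  have -> : trunc N.+1 a = 1 *: single N (a N) + trunc N a.
    apply/funext => i; rewrite !fctE /single /trunc scale1r ltnS leq_eqVlt.
    by case: eqP => [->|_] /=; rewrite ?ltnn ?addr0 ?add0r.
  rewrite (extZD 1 Ld (l2_single N (Aa N)) (l2_trunc N Aa)) scale1r IH tL//.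
  by rewrite !series_ipE big_nat_recr//= addrC.
have tl : l2strong A t.
  apply/l2strongP; split=> //; exists (l2_dual_norm A L ^+ 2).
  exact: dual_norm_sqbounded.
exists t => //; apply: dual_eq_trunc => //; first exact: phi_l2_dual.
by move=> N a Aa; rewrite ext_phi_trunc// Ltrunc.
Qed.

(** On a sequence with one nonzero entry the series is eventually constant and reads off a t_n^*,
    whatever [t] is; nondegeneracy cancels a. *)
Lemma phi_inj t s : phi A t = phi A s -> t = s.
Proof.
move=> ts; apply/funext => n; rewrite -[t n]adjK -[s n]adjK; congr adj.
apply/eqP; rewrite -subr_eq0; apply/eqP.
apply: (mul_nondegenerate_eq0 A_Cstar A_nondegenerate) => a Aa.
rewrite mulrBr -(@phi_single n a t (mkl2 (l2_single n Aa)))//.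
by rewrite -(@phi_single n a s (mkl2 (l2_single n Aa)))// ts subrr.
Qed.

End Dual.

(** * The multiplier module and the adjointable maps *)

Section MultiplierModule.
Context {R : realType} {H : hilbertType R}.
Variable A : set (bop H).
Hypothesis A_Cstar : Cstar_algebra A.
Hypothesis A_nondegenerate : acts_nondegenerately A.
Implicit Types (c d t s x y : nat -> bop H) (z : H).

(** The bound supplies strong limits; the rows a c supply norm convergence after multiplication by
    elements of [A]. *)
Definition pointwise_l2 c :=
  [/\ forall n, multipliers A (c n), exists K, sqbounded c K &
      forall a, A a -> l2 A (lact a c)].

Lemma strict_cvg_unique (u : nat -> bop H) m m' :
  strict_cvg A u m -> strict_cvg A u m' -> m = m'.
Proof.
move=> [_ um] [_ um']; apply/eqP; rewrite -subr_eq0; apply/eqP.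
apply: (mul_nondegenerate_eq0 A_Cstar A_nondegenerate) => a Aa; rewrite mulrBr.
have [am _] := um a Aa; have [am' _] := um' a Aa.
by rewrite (@cvg_rnorm_unique R (bop H) _ _ _ _ _ _ am am') subrr.
Qed.

(** Multiplied by u on the right, the series converges in norm, which bounds every partial form at u
    z by |m| |z|^2. For fixed [N] the form is continuous, and u z tends to z. *)
Lemma strict_cvg_sqbounded c m : strict_cvg A (series (ip_terms c c)) m ->
  sqbounded c (opnorm m).
Proof.
move=> [_ cm]; split=> [|N z]; first exact: opnorm_ge0.
have FF := unit_filter_proper A_Cstar.
set s := \sum_(i <- index_iota 0 N) c i * adj (c i).
have q0 : 0 <= opnorm s by exact: opnorm_ge0.
apply/ler_addgt0Pr => e e0.
(* Replacing z by u z costs two errors of at most |s| |z| d each; the 1 keeps the divisor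
   positive. *)
pose d := e / (2 * opnorm s * rnorm z + 1).
have sz : 0 <= 2 * opnorm s * rnorm z by rewrite !mulr_ge0 ?rnorm_ge0.
have d0 : 0 < d by rewrite divr_gt0// ltr_wpDl.
have /cvg_rnormP/(_ _ d0) uz := unit_cvg A_Cstar A_nondegenerate (z := z).
have [u [[Au _ u1] uzd]] := filter_ex (filterI (near_unit A) uz).
have nuz : rnorm (u z) <= rnorm z by rewrite (le_trans (le_opnorm _ _))// ler_piMl ?rnorm_ge0.
have suz : sqsum (index_iota 0 N) c (u z) <= opnorm m * rnorm z ^+ 2.
  have [_ /cvg_strong_cvg/(_ z) mu] := cm u Au.
  rewrite (le_trans (sqsum_le_limit mu N))// bop_mulE.
  rewrite expr2 mulrA ler_pM ?rnorm_ge0// (le_trans (le_opnorm _ _))// ler_wpM2l//.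
  exact: opnorm_ge0.
have szuz : sqsum (index_iota 0 N) c z =
    sqsum (index_iota 0 N) c (u z) + (rinner (s z) (z - u z) + rinner (s (z - u z)) (u z)).
  by rewrite !sqsum_rinner -/s opB rinnerBl rinnerBr; ring.
have h1 : rinner (s z) (z - u z) <= opnorm s * rnorm z * d.
  by rewrite (le_trans (rinner_le _ _))// ler_pM ?rnorm_ge0 ?le_opnorm// ltW.
have h2 : rinner (s (z - u z)) (u z) <= opnorm s * rnorm z * d.
  rewrite (le_trans (rinner_le _ _))// mulrAC ler_pM ?rnorm_ge0//.
  by rewrite (le_trans (le_opnorm _ _))// ler_wpM2l// ltW.
have dE : d * (2 * opnorm s * rnorm z + 1) = e by rewrite mulfVK// gt_eqF// ltr_wpDl.
rewrite szuz; lra.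
Qed.

Lemma Ml2_pointwise c : Ml2 A c -> pointwise_l2 c.
Proof.
move=> [cA [m cm]]; have cK := strict_cvg_sqbounded cm.
split=> //; first by exists (opnorm m).
move=> a Aa; split; first by move=> n; have [_ /(_ a Aa)] := cA n.
apply/cvg_ex; exists (a * m * adj a).
rewrite (_ : series _ = fun n => a * series (ip_terms c c) n * adj a).
  by apply: cvg_mulr; have [_ /(_ a Aa)[]] := cm.
by apply/funext => n; rewrite series_ip_lactl series_ip_lactr mulrA.
Qed.

(** The strong limit T is the candidate. Multiplying by a on the left gives the series of a c
    against d, which converges in norm; multiplying on the right gives the adjoint of the series of
    a^* d against c. Both limits are in [A], so T is a multiplier. *)
Lemma pointwise_l2_cross c d : pointwise_l2 c -> pointwise_l2 d ->
  exists T, strict_cvg A (series (ip_terms c d)) T /\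
            strong_cvg (series (ip_terms c d)) T.
Proof.
move=> [cA [K cK] cl] [dA [L dL] dl].
have [T [cT _]] := cross_strong_cvg cK dL.
have strongM (a b : bop H) : strong_cvg (fun n => a * series (ip_terms c d) n * b) (a * T * b).
  move=> z; rewrite !bop_mulE.
  apply: (cvg_lipschitz (g := a) (K := opnorm a) _ (@cT (b z))) => x y.
  by rewrite -opB le_opnorm.
have left_cvg a : A a -> (fun n => a * series (ip_terms c d) n) @ \oo --> a * T /\ A (a * T).
  move=> Aa; have := cross_cvg ((l2P A _).1 (cl a Aa)).2 dL => /cvg_ex[p].
  rewrite (_ : series _ = fun n => a * series (ip_terms c d) n); last first.
    by apply/funext => n; rewrite series_ip_lactl.
  move=> pP; have <- : p = a * T.
    apply: strong_cvg_unique (cvg_strong_cvg pP) _.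
    by have := strongM a 1; rewrite mulr1.
  split=> //; apply: (Cstar_lim A_Cstar _ pP) => n.
  rewrite -series_ip_lactl; apply: ip_in_Cstar => // i; last by case: (dA i).
  by have [_ /(_ a Aa)] := cA i.
have right_cvg a : A a -> (fun n => series (ip_terms c d) n * a) @ \oo --> T * a /\ A (T * a).
  move=> Aa; have Aaa := Cstar_adj A_Cstar Aa.
  have := cross_cvg ((l2P A _).1 (dl _ Aaa)).2 cK => /cvg_ex[p pP].
  have := cvg_adj pP.
  rewrite (_ : (fun n => adj _) = fun n => series (ip_terms c d) n * a); last first.
    by apply/funext => n; rewrite adj_series_ip series_ip_lactr adjK.
  move=> {}pP; have TaE : adj p = T * a.
    apply: strong_cvg_unique (cvg_strong_cvg pP) _.
    by have := strongM 1 a; rewrite mul1r.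
  rewrite -TaE; split=> //; apply: (Cstar_lim A_Cstar _ pP) => n.
  rewrite -[a]adjK -series_ip_lactr -adj_series_ip; apply: Cstar_adj => //.
  apply: ip_in_Cstar => // i; last by case: (cA i).
  by have [_ /(_ _ Aaa)] := dA i.
exists T; split=> //; split=> [|a Aa].
  by split=> a Aa; [case: (right_cvg a Aa)|case: (left_cvg a Aa)].
by split; [case: (left_cvg a Aa)|case: (right_cvg a Aa)].
Qed.

Lemma Ml2P c : Ml2 A c <-> pointwise_l2 c.
Proof.
split=> [|cl]; first exact: Ml2_pointwise.
have [T [cT _]] := pointwise_l2_cross cl cl.
by split; [case: cl|exists T].
Qed.

Lemma l2_Ml2 : l2 A `<=` Ml2 A.
Proof.
move=> x xl; apply/Ml2P; split; last by move=> a Aa; exact: l2_lactA.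
  by move=> n; apply: multipliers_sub => //; case: xl.
exact: (l2_bounded A_Cstar).
Qed.

Lemma Ml2_l2strong : Ml2 A `<=` l2strong A.
Proof.
by move=> c /Ml2P[cA cK _]; apply/l2strongP; split=> // n; case: (cA n).
Qed.

Lemma Ml2_ZD (k : R[i]) c d : Ml2 A c -> Ml2 A d -> Ml2 A (k *: c + d).
Proof.
move=> cl dl; apply/Ml2P; move: (cl) (dl) => /Ml2P[cA _ ca] /Ml2P[dA _ da].
have cdl : l2strong A (k *: c + d) by apply: l2strong_ZD => //; exact: Ml2_l2strong.
split; last 1 first.
- move=> a Aa; have -> : lact a (k *: c + d) = k *: lact a c + lact a d.
    by apply/funext => n; rewrite /lact !fctE mulrDr -scale_opAr.
  by apply: l2_ZD => //; [exact: ca|exact: da].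
- by move=> n; have [? ?] := cA n; have [? ?] := dA n; split; [exact: LM_ZD|exact: RM_ZD].
- exact: l2strong_bounded cdl.
Qed.

Lemma Ml2_lact b c : multipliers A b -> Ml2 A c -> Ml2 A (lact b c).
Proof.
move=> bA /Ml2P[cA [K cK] ca]; apply/Ml2P; split.
- by move=> n; exact: multipliersM.
- by eexists; exact: sqbounded_lact cK.
move=> a Aa; have -> : lact a (lact b c) = lact (a * b) c.
  by apply/funext => n; rewrite /lact mulrA.
by apply: ca; case: bA => _; exact.
Qed.

Lemma Ml2_innerP c d : Ml2 A c -> Ml2 A d ->
  strict_cvg A (series (ip_terms c d)) (Ml2_inner A c d).
Proof.
move=> /Ml2P cl /Ml2P dl; have [T [cT _]] := pointwise_l2_cross cl dl.
exact: (xgetI 0 cT).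
Qed.

Lemma Ml2_normE c : Ml2 A c -> Ml2_norm A c = l2strong_norm c.
Proof.
move=> cl; have /Ml2P cl' := cl; have [T [cT cS]] := pointwise_l2_cross cl' cl'.
by rewrite (l2strong_norm_lim cS) /Ml2_norm (strict_cvg_unique (Ml2_innerP cl cl) cT).
Qed.

(** Testing the adjoint relation on sequences with a single entry a yields a (b t_n)^* = a w^* for
    the n-th entry w of [Ls b], and nondegeneracy cancels a. *)
Lemma adjoint_lact t Ls : l2strong A t -> is_adjoint (phi A t) Ls ->
  forall b, val (Ls b) = lact (val b) t.
Proof.
move=> tl Lst b; apply/funext => n; rewrite /lact.
set w := val (Ls b) n; rewrite -[w]adjK -[_ * _]adjK; congr adj.
apply/eqP; rewrite -subr_eq0; apply/eqP.
apply: (mul_nondegenerate_eq0 A_Cstar A_nondegenerate) => a Aa.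
have := Lst (mkl2 (l2_single A_Cstar n Aa)) b.
rewrite (phi_single (N := n) (b := a))//= /l2_inner.
rewrite (limn_eq (@cvg_eventually0 _ _ _ (val (Ls b)) _ (@single0 _ _ n a))).
by rewrite series_single adjM mulrBr mulrA => ->; rewrite subrr.
Qed.

Lemma phi_adjointable c : Ml2 A c -> l2_adjointable A (phi A c).
Proof.
move=> cl; have cs := Ml2_l2strong cl; split; first exact: phi_l2_dual.
have /Ml2P[_ _ ca] := cl.
pose Ls (b : set_type A) : set_type (l2 A) := mkl2 (ca _ (set_mem (valP b))).
exists Ls => x b; apply/esym/limn_eq.
rewrite (_ : series _ = fun n => series (ip_terms (val x) c) n * adj (val b)).
  by apply: cvg_mulr; exact: phi_lim.
by apply/funext => n; rewrite series_ip_lactr.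
Qed.

(** The adjoint is forced to be b |-> b t, so its values show that b t lies in l^2(A); their entries
    b t_n in [A] upgrade the left multipliers t_n to two-sided ones. *)
Lemma adjointable_phi L : l2_adjointable A L -> exists2 c, Ml2 A c & phi A c = L.
Proof.
move=> [Ld [Ls LLs]]; have [t tl tL] := phi_surj A_Cstar A_nondegenerate Ld.
exists t => //; rewrite -tL in LLs; have Lsb := adjoint_lact tl LLs.
have tl2 a : A a -> l2 A (lact a t).
  by move=> Aa; rewrite -(Lsb (exist _ a (mem_set Aa))); exact: set_mem (valP _).
have [tA tK] := (l2strongP A t).1 tl.
apply/Ml2P; split=> // n; split; first exact: tA.
by move=> a Aa; have [/(_ n)] := tl2 a Aa.
Qed.

Lemma adjointable_innerE t s : Ml2 A t -> Ml2 A s ->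
  l2_adjointable_inner A (phi A t) (phi A s) = Ml2_inner A t s.
Proof.
move=> tM sM; have [mA mP] := Ml2_innerP tM sM; set m := Ml2_inner A t s in mA mP *.
have tl := Ml2_l2strong tM; have sl := Ml2_l2strong sM.
(* Every adjoint sends b to b t, so its image under [phi A s] is \sum_n b t_n s_n^* = b m. *)
have phi_m Ls : is_adjoint (phi A t) Ls -> forall b, phi A s (Ls b) = val b * m.
  move=> Lst b; apply: phi_eq => //; rewrite (adjoint_lact tl Lst).
  rewrite (_ : series _ = fun n => val b * series (ip_terms t s) n).
    by have [] := mP _ (set_mem (valP b)).
  by apply/funext => n; rewrite series_ip_lactl.
apply: xget_unique.
  by split=> //; have [_ [Ls LsP]] := phi_adjointable tM; exists Ls => //; exact: phi_m.
move=> y [_ [Ls LsP yP]]; apply/eqP; rewrite -subr_eq0; apply/eqP.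
apply: (mul_nondegenerate_eq0 A_Cstar A_nondegenerate) => a Aa.
have := yP (exist _ a (mem_set Aa)); rewrite (phi_m _ LsP)/= => h.
by rewrite mulrBr h subrr.
Qed.

(** Shared by the two isomorphisms, over [A] and over its multipliers. The module structure of [Y]
    is transported from [X] through [phi]. *)
Lemma phi_iso (S : set (bop H)) (X : set (nat -> bop H)) nX Y :
  X `<=` l2strong A ->
  (forall (k : R[i]) t s, X t -> X s -> X (k *: t + s)) ->
  (forall b t, S b -> X t -> X (lact b t)) ->
  (forall b, S b -> S (adj b)) ->
  (forall t, X t -> Y (phi A t)) ->
  (forall L, Y L -> exists2 t, X t & phi A t = L) ->
  (forall t, X t -> nX t = l2strong_norm t) ->
  antilinear_isometric_iso S X nX Y (l2_dual_norm A) (phi A).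
Proof.
move=> Xl XZD Xlact Sadj XY YX nXE.
have antilin (k : R[i]) t s : X t -> X s -> phi A (k *: t + s) = k^* *: phi A t + phi A s.
  by move=> /Xl tl /Xl sl; exact: phi_antilinear.
have phi_ract b t : X t -> phi A (lact b t) = ract (phi A t) (adj b).
  by move=> /Xl tl; exact: phi_lact.
split; [by split| |split| |].
- split=> [k L K /YX[t tX <-] /YX[s sX <-]|b L Sb /YX[t tX <-]].
    (* A multiple by k in [Y] comes from the multiple by the conjugate of k in [X]. *)
    by rewrite -[k]conjCK -antilin//; apply/XY/XZD.
  by rewrite -[b]adjK -phi_ract//; apply/XY/Xlact => //; exact: Sadj.
- by move=> t /XY.
- by move=> t s _ _; exact: phi_inj.
- by move=> L /YX[t tX <-]; exists t.
- by split=> // b t _ /phi_ract.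
- by move=> t tX; rewrite nXE//; apply: phi_norm => //; exact: Xl.
Qed.

End MultiplierModule.

Theorem theorem2p3 (R : realType) (H : hilbertType R) (A : set (bop H))
    (A_Cstar : Cstar_algebra A) (A_nondegenerate : acts_nondegenerately A) :
  (l2 A `<=` Ml2 A /\ Ml2 A `<=` l2strong A) /\
  [/\ forall t a : nat -> bop H, l2strong A t -> l2 A a ->
        cvgn (series (fun n => a n * adj (t n))) /\
        A (limn (series (fun n => a n * adj (t n)))),
      antilinear_isometric_iso A (l2strong A) l2strong_norm
        (l2_dual A) (l2_dual_norm A) (phi A),
      antilinear_isometric_iso (multipliers A) (Ml2 A) (Ml2_norm A)
        (l2_adjointable A) (l2_dual_norm A) (phi A),
      forall t s : nat -> bop H, Ml2 A t -> Ml2 A s ->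
        l2_adjointable_inner A (phi A t) (phi A s) = Ml2_inner A t s &
      forall x y : set_type (l2 A), phi A (val x) y = l2_inner (val y) (val x)].
Proof.
have A_LM : A `<=` LM A by move=> a Aa; case: (multipliers_sub A_Cstar Aa).
split; first by split; [exact: l2_Ml2|exact: Ml2_l2strong].
split=> //.
- by move=> t a tl al; split; [exact: (ip_cvg tl al)|exact: (ip_lim_in_Cstar A_Cstar tl al)].
- apply: phi_iso => //.
  + exact: l2strong_ZD.
  + by move=> b t /A_LM; exact: l2strong_lact.
  + exact: Cstar_adj.
  + exact: phi_l2_dual.
  + exact: phi_surj.
- apply: phi_iso => //.
  + exact: Ml2_l2strong.
  + exact: Ml2_ZD.
  + exact: Ml2_lact.
  + exact: multipliers_adj.
  + exact: phi_adjointable.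
  + exact: adjointable_phi.
  + exact: Ml2_normE.
- exact: adjointable_innerE.
Qed.
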